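(* Let $X \subset \mathbb{R}^n$ be a closed semi-algebraic set and let $G \colon X \to \mathbb{R}^m$ be a continuous semi-algebraic mapping. Then the set $$\{F\in L(\mathbb{R}^n, \mathbb{R}^m) \ : \ (F + G)(X) \text{ is closed in } \mathbb{R}^m\}$$ is semi-algebraic and contains an open dense semi-algebraic subset of $L(\mathbb{R}^n, \mathbb{R}^m)$.
   Context: $L(\mathbb{R}^n,\mathbb{R}^m)$ denotes the space of all linear mappings $\mathbb{R}^n\to\mathbb{R}^m$, identified with $\mathbb{R}^{m\times n}$ via matrices in the canonical bases (so semi-algebraicity, openness and density refer to this identification). For $F \in L(\mathbb{R}^n,\mathbb{R}^m)$, $(F+G)(X) = \{F(x)+G(x) : x \in X\}$. A subset of $\mathbb{R}^N$ is semi-algebraic if it is a finite union of sets of the form $\{x : f(x)=0,\ g_1(x)>0,\dots,g_k(x)>0\}$ with $f,g_i$ polynomials; a mapping between semi-algebraic sets is semi-algebraic if its graph is semi-algebraic. *)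

(* Defs.v *)
From HB Require Import structures.
From mathcomp Require Import all_boot all_order all_algebra.
From mathcomp Require Import all_classical all_reals all_analysis.
Set Implicit Arguments. Unset Strict Implicit. Unset Printing Implicit Defensive.
Import Order.TTheory GRing.Theory Num.Theory.
Import numFieldNormedType.Exports.
Local Open Scope ring_scope.
Local Open Scope classical_set_scope.

Inductive pterm (R : Type) (I : Type) : Type :=
| PVar of I
| PConst of R
| PAdd of pterm R I & pterm R I
| PMul of pterm R I & pterm R I.

Fixpoint peval (R : ringType) (I : Type) (p : pterm R I) (x : I -> R) : R :=
  match p with
  | PVar i => x i
  | PConst c => c
  | PAdd p q => peval p x + peval q x
  | PMul p q => peval p x * peval q x
  end.

(* Semi-algebraic subsets of R^(m*n), realised as m x n matrices
   (coordinates = entries); column vectors 'cV_n are the case 'M_(n,1). *)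
Definition semialgebraic (R : realType) (m n : nat) (S : set 'M[R]_(m, n)) : Prop :=
  exists s : seq (pterm R ('I_m * 'I_n) * seq (pterm R ('I_m * 'I_n))),
    S = [set A | has (fun fg =>
           (peval fg.1 (fun ij => A ij.1 ij.2) == 0)
           && all (fun g => 0 < peval g (fun ij => A ij.1 ij.2)) fg.2) s].

Definition semialgebraic_map (R : realType) (n m : nat)
  (X : set 'cV[R]_n) (G : 'cV[R]_n -> 'cV[R]_m) : Prop :=
  semialgebraic [set col_mx x (G x) | x in X].

(* Main.v *)
Require Import Defs.
From HB Require Import structures.
From mathcomp Require Import all_boot all_order all_algebra.
From mathcomp Require Import all_classical all_reals all_analysis.
From mathcomp.real_closed Require polyrcf ordered_qelim qe_rcf.
From mathcomp Require Import lra ring zify.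
Set Implicit Arguments. Unset Strict Implicit. Unset Printing Implicit Defensive.
Import Order.TTheory GRing.Theory Num.Theory.
Import numFieldNormedType.Exports.
Local Open Scope ring_scope.
Local Open Scope classical_set_scope.

(* By quantifier elimination T and its interior are semialgebraic, and any
   semialgebraic set either contains or misses some nonempty open subset of a
   given nonempty open set; so it is enough to rule out that (F + G)(X) fails to
   be closed for all F in a nonempty open set.
   For such an F, take y in the closure of the image but not in the image. The
   sublevel sets of x |-> |F x + G x - y| are then unbounded, and a variational
   principle gives, at every large scale r, a point x of X with |x| ~ r at which
   this function is nearly minimal, up to the slope 2 / r. By Baire's theorem we
   may assume that, throughout an open set of F, a bound on y, a coordinate i of
   the residual F x + G x - y that is nonzero, a coordinate k of x comparable to
   r, and the signs of both are constant.
   Now move F on a segment in the direction of the elementary matrix at (i, k).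
   Definable choice selects x and y along the segment, and uniform finiteness
   bounds their total variation by O(r) and O(1). Using the point x chosen for
   one parameter as a competitor for the previous parameter, the norm of the
   residual grows at speed at least r / 2n, up to the variation of y and 2 / r
   times the variation of x. But this norm is at most 1, so r is bounded. *)

(** * Quantifier elimination *)

Section QuantifierFree.
Variable R : realType.

(** Boolean combinations of polynomial inequalities, taken as predicates on valuations and not as
    syntax; closing the class under equivalence allows free rewriting of the predicate. *)
Inductive qf (V : Type) : ((V -> R) -> Prop) -> Prop :=
| qf_pos p : qf (fun e => 0 < peval p e)
| qf_not P : qf P -> qf (fun e => ~ P e)
| qf_and P Q : qf P -> qf Q -> qf (fun e => P e /\ Q e)
| qf_ext P Q : (forall e, P e <-> Q e) -> qf P -> qf Q.

Definition popp V (p : pterm R V) := PMul (PConst V (-1)) p.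

Lemma qf_eq0 V (p : pterm R V) : qf (fun e => peval p e = 0).
Proof.
apply: qf_ext (qf_and (qf_not (qf_pos p)) (qf_not (qf_pos (popp p)))) => e /=.
rewrite mulN1r oppr_gt0; split=> [[h1 h2]|->]; last by rewrite ltxx.
by apply/eqP; rewrite eq_le !leNgt; apply/andP; split; apply/negP.
Qed.

Lemma qf_or V (P Q : (V -> R) -> Prop) : qf P -> qf Q -> qf (fun e => P e \/ Q e).
Proof.
move=> hP hQ; apply: qf_ext (qf_not (qf_and (qf_not hP) (qf_not hQ))) => e.
by split=> [|[?|?] []//]; have [?|?] := pselect (P e); have [?|?] := pselect (Q e); tauto.
Qed.

Lemma qf_true V : qf (fun _ : V -> R => True).
Proof. by apply: qf_ext (qf_pos (PConst V 1)) => e /=; rewrite ltr01. Qed.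

Fixpoint psubst V W (s : W -> pterm R V) (p : pterm R W) : pterm R V :=
  match p with
  | PVar i => s i
  | PConst c => PConst V c
  | PAdd p q => PAdd (psubst s p) (psubst s q)
  | PMul p q => PMul (psubst s p) (psubst s q)
  end.

Lemma peval_psubst V W (s : W -> pterm R V) p e :
  peval (psubst s p) e = peval p (fun w => peval (s w) e).
Proof. by elim: p => //= p -> q ->. Qed.

Lemma qf_subst V W (s : W -> pterm R V) (P : (W -> R) -> Prop) :
  qf P -> qf (fun e => P (fun w => peval (s w) e)).
Proof.
elim=> {P} [p|P _ IH|P Q _ IHP _ IHQ|P Q PQ _ IH].
- by apply: qf_ext (qf_pos (psubst s p)) => e; rewrite peval_psubst.
- exact: qf_not.
- exact: qf_and.
- exact: qf_ext IH.
Qed.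

(** * Disjunctive normal forms *)

Definition dnf V := seq (pterm R V * seq (pterm R V)).

Definition dnf_holds V (s : dnf V) (e : V -> R) : bool :=
  has (fun fg => (peval fg.1 e == 0) && all (fun g => 0 < peval g e) fg.2) s.

(** Two equations become one, since a sum of two squares vanishes only if both terms do. *)
Definition dnf_and V (s t : dnf V) : dnf V :=
  [seq (PAdd (PMul a.1 a.1) (PMul b.1 b.1), a.2 ++ b.2) | a <- s, b <- t].

Lemma dnf_holds_and V (s t : dnf V) e :
  dnf_holds (dnf_and s t) e = dnf_holds s e && dnf_holds t e.
Proof.
rewrite /dnf_holds; elim: s => [|a s IH] //=; rewrite has_cat {}IH andb_orl.
congr (_ || _); elim: t => [|b t IH] /=; first by rewrite andbF.
rewrite {}IH andb_orr; congr (_ || _).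
rewrite all_cat -!expr2 paddr_eq0 ?sqr_ge0 // !sqrf_eq0.
by rewrite -!andbA; congr (_ && _); rewrite !andbA; congr (_ && _); rewrite andbC.
Qed.

(** The induction carries normal forms of the predicate and of its complement together, so that
    negation only swaps them. *)
Lemma qf_dnf V (P : (V -> R) -> Prop) :
  qf P -> exists s : dnf V, forall e, P e <-> dnf_holds s e.
Proof.
move=> hP; suff [s [t [_ hs]]] : exists s : dnf V, exists t : dnf V,
  (forall e, ~ P e <-> dnf_holds t e) /\ (forall e, P e <-> dnf_holds s e) by exists s.
elim: hP => {P} [p|P _ [s [t [h1 h2]]]|P Q _ [s [t [h1 h2]]] _ [s' [t' [h1' h2']]]|P Q PQ _ [s [t [h1 h2]]]].
- exists [:: (PConst V 0, [:: p])], [:: (p, [::]); (PConst V 0, [:: popp p])].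
  rewrite /dnf_holds; split=> e /=; rewrite ?eqxx /= ?andbT ?orbF //.
  rewrite mulN1r oppr_gt0 -le_eqVlt leNgt; split; first by move/negP.
  by move/negP.
- exists t, s; split => // e; rewrite -h2; split; first exact: contrapT.
  by move=> ? ?.
- exists (dnf_and s s'), (t ++ t'); split=> e.
    rewrite /dnf_holds has_cat -/(dnf_holds t e) -/(dnf_holds t' e).
    rewrite not_andE; split=> [[/h1->//|/h1'->]|/orP[/h1|/h1']]; first by rewrite orbT.
      by left.
    by right.
  by rewrite dnf_holds_and h2 h2'; split=> [[-> ->]|/andP].
- exists s, t; split => e; first by rewrite -h1 PQ.
  by rewrite -h2 PQ.
Qed.

(** * Translation to first-order formulas and back *)

Import ordered_qelim qe_rcf.

Fixpoint term_of_pterm (t : pterm R nat) : GRing.term R :=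
  match t with
  | PVar i => GRing.Var R i
  | PConst c => GRing.Const c
  | PAdd p q => GRing.Add (term_of_pterm p) (term_of_pterm q)
  | PMul p q => GRing.Mul (term_of_pterm p) (term_of_pterm q)
  end.

Lemma eval_term_of_pterm t (e : seq R) :
  GRing.eval e (term_of_pterm t) = peval t (fun i => e`_i).
Proof. by elim: t => //= p -> q ->. Qed.

Lemma qf_formula (P : (nat -> R) -> Prop) : qf P ->
  exists f : ord.formula R, forall e : seq R, ord.holds e f <-> P (fun i => e`_i).
Proof.
elim=> {P} [p|P _ [f hf]|P Q _ [f hf] _ [g hg]|P Q PQ _ [f hf]].
- exists (ord.Lt (GRing.NatConst R 0) (term_of_pterm p)) => e /=.
  by rewrite eval_term_of_pterm.
- by exists (ord.Not f) => e /=; rewrite hf.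
- by exists (ord.And f g) => e /=; rewrite hf hg.
- by exists f => e; rewrite hf PQ.
Qed.

(** [E] lists the polynomials put in place of the numbered variables. Inverses get the dummy value
    0; evaluations are compared only for terms without them. *)
Fixpoint pterm_of_term V (E : seq (pterm R V)) (t : GRing.term R) : pterm R V :=
  match t with
  | GRing.Var i => nth (PConst V 0) E i
  | GRing.Const c => PConst V c
  | GRing.NatConst n => PConst V n%:R
  | GRing.Add p q => PAdd (pterm_of_term E p) (pterm_of_term E q)
  | GRing.Opp p => popp (pterm_of_term E p)
  | GRing.NatMul p n => PMul (PConst V n%:R) (pterm_of_term E p)
  | GRing.Mul p q => PMul (pterm_of_term E p) (pterm_of_term E q)
  | GRing.Inv p => PConst V 0
  | GRing.Exp p n => iter n (PMul (pterm_of_term E p)) (PConst V 1)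
  end.

Lemma peval_pterm_of_term V (E : seq (pterm R V)) t e : GRing.rterm t ->
  peval (pterm_of_term E t) e = GRing.eval [seq peval p e | p <- E] t.
Proof.
elim: t => //=.
- move=> i _; have [iE|Ei] := ltnP i (size E).
    by rewrite (nth_map (PConst V 0)).
  by rewrite !nth_default ?size_map.
- by move=> p IHp q IHq /andP[/IHp -> /IHq ->].
- by move=> p IHp /IHp ->; rewrite mulN1r.
- by move=> p IHp n /IHp ->; rewrite mulr_natl.
- by move=> p IHp q IHq /andP[/IHp -> /IHq ->].
- move=> p IHp n /IHp <-; elim: n => //= n ->; rewrite exprS //.
Qed.

Lemma qf_formula_eval V (E : seq (pterm R V)) (f : ord.formula R) :
  ord.qf_form f -> ord.rformula f ->
  qf (fun e => ord.qf_eval [seq peval p e | p <- E] f).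
Proof.
have qflt t1 t2 : GRing.rterm t1 -> GRing.rterm t2 ->
    qf (fun e : V -> R => GRing.eval [seq peval p e | p <- E] t1 <
                          GRing.eval [seq peval p e | p <- E] t2).
  move=> h1 h2; apply: qf_ext (qf_pos (PAdd (pterm_of_term E t2) (popp (pterm_of_term E t1)))).
  by move=> e /=; rewrite !peval_pterm_of_term // mulN1r subr_gt0.
elim: f => //=.
- by case=> _ _; [apply: qf_ext (@qf_true V)|apply: qf_ext (qf_not (@qf_true V))].
- move=> t1 t2 _ /andP[h1 h2].
  apply: qf_ext (qf_eq0 (PAdd (pterm_of_term E t2) (popp (pterm_of_term E t1)))) => e /=.
  rewrite !peval_pterm_of_term // mulN1r; split=> [/eqP|/eqP->]; last by rewrite subrr.
  by rewrite subr_eq0 eq_sym.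
- by move=> t1 t2 _ /andP[h1 h2]; apply: qflt.
- move=> t1 t2 _ /andP[h1 h2]; apply: qf_ext (qf_not (qflt _ _ h2 h1)) => e.
  by rewrite leNgt; split=> /negP.
- move=> f IHf g IHg /andP[/IHf{}IHf /IHg{}IHg] /andP[/IHf{}IHf /IHg{}IHg].
  by apply: qf_ext (qf_and IHf IHg) => e; split=> [[-> ->]|/andP].
- move=> f IHf g IHg /andP[/IHf{}IHf /IHg{}IHg] /andP[/IHf{}IHf /IHg{}IHg].
  by apply: qf_ext (qf_or IHf IHg) => e; split=> [/orP|/orP].
- move=> f IHf g IHg /andP[/IHf{}IHf /IHg{}IHg] /andP[/IHf{}IHf /IHg{}IHg].
  apply: qf_ext (qf_or (qf_not IHf) IHg) => e; rewrite implybE.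
  by split=> [[/negP->//|->]|/orP[/negP|]]; [rewrite orbT|left|right].
- move=> f IHf h1 h2; apply: qf_ext (qf_not (IHf h1 h2)) => e.
  by split=> /negP.
Qed.

(** Each quantifier overwrites one entry of the environment; a single new environment, free at the
    indices in [I], replaces the chain of updates. *)
Lemma holds_foldExists (f : ord.formula R) (I : seq nat) (e : seq R) :
  ord.holds e (foldr (@ord.Exists R) f I) <->
  exists e' : seq R, (forall k, k \notin I -> e'`_k = e`_k) /\ ord.holds e' f.
Proof.
elim: I e => [|i I IH] e /=.
  split=> [h|[e' [h1 h2]]]; first by exists e.
  by apply: ord.eq_holds h2 => k; rewrite h1.
split=> [[x /IH[e' [h1 h2]]]|[e' [h1 h2]]].
  exists e'; split=> // k; rewrite inE negb_or => /andP[ki kI].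
  by rewrite h1 // nth_set_nth /= (negbTE ki).
exists e'`_i; apply/IH; exists e'; split=> // k kI.
rewrite nth_set_nth /=; case: eqP => [->//|/eqP ki].
by rewrite h1 // inE negb_or ki.
Qed.

Definition sumf (V W : Type) (e : V -> R) (g : W -> R) (i : V + W) : R :=
  match i with inl v => e v | inr w => g w end.

(* Tarski-Seidenberg *)
Lemma qf_exists (V W : finType) (P : (V + W -> R) -> Prop) :
  qf P -> qf (fun e => exists g, P (sumf e g)).
Proof.
move=> hP; pose idx (i : V + W) : nat := enum_rank i.
have [f hf] := qf_formula (qf_subst (fun i => PVar R (idx i)) hP).
(* The slots of [W] are quantified; in [E] they hold the placeholder 0, which the quantifiers
   overwrite, while those of [V] hold the free variables. *)
pose I := [seq idx (inr w) | w <- enum W].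
pose F := ord.quantifier_elim (@wproj R) (ord.to_rform (foldr (@ord.Exists R) f I)).
pose E : seq (pterm R V) :=
  [seq match i with inl v => PVar R v | inr _ => PConst V 0 end | i <- enum {: V + W}].
have /andP[qF rF] : ord.qf_form F && ord.rformula F.
  apply: (ord.quantifier_elim_wf (@wf_QE_wproj R)).
  exact: ord.to_rform_rformula.
apply: qf_ext (qf_formula_eval E qF rF) => e.
have EE v : [seq peval p e | p <- E]`_(idx (inl v)) = e v.
  rewrite -map_comp (nth_map (inl v)) /idx ?nth_enum_rank //.
  by rewrite -cardE ltn_ord.
have -> : ord.qf_eval [seq peval p e | p <- E] F <->
    ord.holds [seq peval p e | p <- E] (foldr (@ord.Exists R) f I).
  by split=> /rcf_satP.
rewrite holds_foldExists; split=> [[e' [h1 /hf h2]]|[g Pg]].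
  exists (fun w => e'`_(idx (inr w))).
  suff -> : sumf e (fun w => e'`_(idx (inr w))) = (fun i => e'`_(idx i)) by [].
  apply/funext => -[v|w] //=; rewrite -EE h1 //; apply/mapP => -[w _].
  by move/ord_inj/enum_rank_inj.
exists [seq sumf e g i | i <- enum {: V + W}].
have Eidx i : [seq sumf e g i | i <- enum {: V + W}]`_(idx i) = sumf e g i.
  by rewrite (nth_map i) /idx ?nth_enum_rank // -cardE ltn_ord.
split; last first.
  apply/hf => /=; suff -> : (fun w => [seq sumf e g i | i <- enum {: V + W}]`_(idx w)) = sumf e g by [].
  exact/funext.
move=> k kI; have [kE|kE] := ltnP k #|{: V + W}|; last first.
  have szE : size (enum {: V + W}) = #|{: V + W}| by rewrite [RHS]cardE.
  rewrite nth_default; last by rewrite size_map szE.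
  by rewrite nth_default // size_map /E size_map szE.
pose i := enum_val (Ordinal kE).
have ik : k = idx i by rewrite /idx /i enum_valK.
rewrite ik Eidx; move: kI; rewrite ik; case: i {ik} => [v|w]; first by rewrite EE.
by case/negP; apply/mapP; exists w; rewrite ?mem_enum.
Qed.

End QuantifierFree.

(** * Spaces with coordinates and definable maps *)

(** Identifies a type with a finite power of [R], so that one notion of semialgebraic set serves
    reals, matrices and products. Products are indexed by disjoint sums, the form in which
    [qf_exists] projects. *)
Record cspace (R : realType) := CSpace {
  car :> Type;
  idx : finType;
  co : car -> idx -> R;
  un : (idx -> R) -> car;
  coK : cancel co un;
  unK : cancel un co }.
Arguments co {R c}.
Arguments un {R c}.

Section Spaces.
Variable R : realType.

Lemma real_coK : cancel (fun (x : R) (_ : unit) => x) (fun f => f tt).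
Proof. by []. Qed.
Lemma real_unK : cancel (fun f => f tt) (fun (x : R) (_ : unit) => x).
Proof. by move=> f; apply/funext => -[]. Qed.
Canonical real_space := CSpace real_coK real_unK.

Lemma mx_coK m n : cancel (fun (A : 'M[R]_(m, n)) ij => A ij.1 ij.2)
  (fun f => \matrix_(i, j) f (i, j)).
Proof. by move=> A; apply/matrixP => i j; rewrite mxE. Qed.
Lemma mx_unK m n : cancel (fun f => \matrix_(i, j) f (i, j))
  (fun (A : 'M[R]_(m, n)) ij => A ij.1 ij.2).
Proof. by move=> f; apply/funext => -[i j]; rewrite mxE. Qed.
Canonical mx_space m n := CSpace (@mx_coK m n) (@mx_unK m n).

Section Prod.
Variables T S : cspace R.
Definition prod_co (z : T * S) := sumf (co z.1) (co z.2).
Definition prod_un (f : idx T + idx S -> R) : T * S :=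
  (un (fun i => f (inl i)), un (fun i => f (inr i))).
Lemma prod_coK : cancel prod_co prod_un.
Proof.
move=> [x y]; rewrite /prod_un /prod_co /=; congr pair.
  by rewrite -[RHS]coK.
by rewrite -[RHS]coK.
Qed.
Lemma prod_unK : cancel prod_un prod_co.
Proof. by move=> f; apply/funext => -[i|i]; rewrite /prod_co /prod_un /= unK. Qed.
Canonical prod_space := CSpace prod_coK prod_unK.
End Prod.

Implicit Types T S U : cspace R.

Definition sa T (P : T -> Prop) := qf (fun e => P (un e)).
Definition polyf T (f : T -> R) := exists p, forall x, f x = peval p (co x).
(** Maps are total and known through their graphs, so that composition carries no condition on
    domains. *)
Definition dmap T S (f : T -> S) := sa (fun z : T * S => z.2 = f z.1).

Lemma sa_ext T (P Q : T -> Prop) : (forall x, P x <-> Q x) -> sa P -> sa Q.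
Proof. by move=> PQ; apply: qf_ext => e. Qed.

Lemma sa_not T (P : T -> Prop) : sa P -> sa (fun x => ~ P x).
Proof. exact: qf_not. Qed.

Lemma sa_and T (P Q : T -> Prop) : sa P -> sa Q -> sa (fun x => P x /\ Q x).
Proof. exact: qf_and. Qed.

Lemma sa_or T (P Q : T -> Prop) : sa P -> sa Q -> sa (fun x => P x \/ Q x).
Proof. exact: qf_or. Qed.

Lemma sa_imp T (P Q : T -> Prop) : sa P -> sa Q -> sa (fun x => P x -> Q x).
Proof.
move=> hP hQ; apply: sa_ext (sa_or (sa_not hP) hQ) => x.
by split=> [[//|//]|PQ]; have [/PQ|] := pselect (P x); [right|left].
Qed.

Lemma sa_const T (P : Prop) : sa (fun _ : T => P).
Proof.
have [p|np] := pselect P; first by apply: qf_ext (@qf_true _ _).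
by apply: qf_ext (qf_not (@qf_true _ _)) => e; split.
Qed.

Lemma sa_fin T (I : finType) (P : I -> T -> Prop) :
  (forall i, sa (P i)) -> sa (fun x => forall i, P i x).
Proof.
move=> hP; suff h (s : seq I) : sa (fun x => forall i, i \in s -> P i x).
  by apply: sa_ext (h (enum I)) => x; split=> h' i; [apply: h'; rewrite mem_enum|].
elim: s => [|i s IH]; first by apply: sa_ext (sa_const T True).
apply: sa_ext (sa_and (hP i) IH) => x; split=> [[h1 h2] j|h].
  by rewrite inE => /predU1P[->//|/h2].
by split=> [|j js]; apply: h; rewrite inE ?eqxx // js orbT.
Qed.

Lemma sa_ex T S (P : T -> S -> Prop) :
  sa (fun z : T * S => P z.1 z.2) -> sa (fun x => exists y, P x y).
Proof.
move=> /qf_exists hP; apply: qf_ext hP => e; split=> [[g]|[y]] /=.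
  by exists (un g).
by exists (co y); rewrite coK.
Qed.

Lemma sa_all T S (P : T -> S -> Prop) :
  sa (fun z : T * S => P z.1 z.2) -> sa (fun x => forall y, P x y).
Proof.
move=> /sa_not/(sa_ex (P := fun x y => ~ P x y))/sa_not; apply: sa_ext => x.
by split=> [h y|h [y]]; [apply: contrapT => nP; apply: h; exists y|exact].
Qed.

Lemma sa_lt_poly T (f g : T -> R) : polyf f -> polyf g -> sa (fun x => f x < g x).
Proof.
move=> [p hp] [q hq]; apply: qf_ext (qf_pos (PAdd q (popp p))) => e /=.
by rewrite hp hq unK mulN1r subr_gt0.
Qed.

Lemma sa_eq_poly T (f g : T -> R) : polyf f -> polyf g -> sa (fun x => f x = g x).
Proof.
move=> hf hg; apply: sa_ext (sa_and (sa_not (sa_lt_poly hf hg)) (sa_not (sa_lt_poly hg hf))).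
move=> x; split=> [[h1 h2]|->]; last by rewrite ltxx.
by apply/eqP; rewrite eq_le !leNgt; apply/andP; split; apply/negP.
Qed.

Lemma polyf_co T i : polyf (fun x : T => co x i).
Proof. by exists (PVar R i). Qed.

Lemma polyf_add T (f g : T -> R) : polyf f -> polyf g -> polyf (fun x => f x + g x).
Proof. by move=> [p hp] [q hq]; exists (PAdd p q) => x; rewrite hp hq. Qed.

Lemma polyf_mul T (f g : T -> R) : polyf f -> polyf g -> polyf (fun x => f x * g x).
Proof. by move=> [p hp] [q hq]; exists (PMul p q) => x; rewrite hp hq. Qed.

Lemma polyf_const T (c : R) : polyf (fun _ : T => c).
Proof. by exists (PConst _ c). Qed.

Lemma sa_pcomp T S (Q : S -> Prop) (f : T -> S) :
  sa Q -> (forall i, polyf (fun x => co (f x) i)) -> sa (fun x => Q (f x)).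
Proof.
move=> hQ /choice[p hp]; apply: qf_ext (qf_subst p hQ) => e.
suff -> : un (fun w => peval (p w) e) = f (un e) by [].
by rewrite -[RHS]coK; congr un; apply/funext => i; rewrite hp unK.
Qed.

Lemma dmap_coord T S (f : T -> S) : (forall i, dmap (fun x => co (f x) i)) -> dmap f.
Proof.
move=> h; have : sa (fun z : T * S => forall i, co z.2 i = co (f z.1) i).
  apply: sa_fin => i.
  apply: (sa_pcomp (f := fun z : T * S => (z.1, co z.2 i) : prod_space T real_space) (h i)).
  move=> [j|[]]; first exact: (polyf_co (inl j : idx (prod_space T S))).
  exact: (polyf_co (inr i : idx (prod_space T S))).
apply: sa_ext => z; split=> [h'|-> //].
by rewrite -[LHS]coK -[RHS]coK; congr un; apply/funext.
Qed.

Lemma dmap_poly T (f : T -> R) : polyf f -> dmap f.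
Proof.
move=> [p hp]; apply: sa_eq_poly; first exact: (polyf_co (inr tt : idx (prod_space T real_space))).
exists (psubst (fun i => PVar R (inl i)) p) => z /=.
by rewrite peval_psubst hp.
Qed.

Lemma dmap_pmap T S (f : T -> S) : (forall i, polyf (fun x => co (f x) i)) -> dmap f.
Proof. by move=> h; apply: dmap_coord => i; apply: dmap_poly. Qed.

(** The value [f x] is quantified as a point of the graph, and projection removes it again. *)
Lemma sa_comp T S (Q : S -> Prop) (f : T -> S) : sa Q -> dmap f -> sa (fun x => Q (f x)).
Proof.
move=> hQ hf; have : sa (fun x => exists y, y = f x /\ Q y).
  apply: sa_ex; apply: sa_and hf _; apply: (sa_pcomp (f := snd) hQ) => i.
  exact: (polyf_co (inr i : idx (prod_space T S))).
by apply: sa_ext => x; split=> [[y [->]]|]; last by exists (f x).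
Qed.

Lemma dmap_id T : dmap (fun x : T => x).
Proof. by apply: dmap_pmap => i; apply: polyf_co. Qed.

Lemma dmap_const T S (c : S) : dmap (fun _ : T => c).
Proof. by apply: dmap_pmap => i; apply: polyf_const. Qed.

Lemma dmap_pair T S U (f : T -> S) (g : T -> U) :
  dmap f -> dmap g -> dmap (fun x => (f x, g x) : prod_space S U).
Proof.
move=> hf hg.
have : sa (fun z : T * (S * U) => z.2.1 = f z.1 /\ z.2.2 = g z.1).
  apply: sa_and.
    apply: (sa_pcomp (f := fun z : T * (S * U) => (z.1, z.2.1) : prod_space T S) hf).
    by move=> [i|i]; [exact: (polyf_co (inl i : idx (prod_space T (prod_space S U))))|
      exact: (polyf_co (inr (inl i) : idx (prod_space T (prod_space S U))))].
  apply: (sa_pcomp (f := fun z : T * (S * U) => (z.1, z.2.2) : prod_space T U) hg).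
  by move=> [i|i]; [exact: (polyf_co (inl i : idx (prod_space T (prod_space S U))))|
      exact: (polyf_co (inr (inr i) : idx (prod_space T (prod_space S U))))].
by apply: sa_ext => -[x [a b]] /=; split=> [[-> ->]|[]].
Qed.

Lemma dmap_comp T S U (g : S -> U) (f : T -> S) :
  dmap g -> dmap f -> dmap (fun x => g (f x)).
Proof.
move=> hg hf; apply: (sa_comp (f := fun z : T * U => (f z.1, z.2) : prod_space S U) hg).
apply: dmap_pair.
  have : sa (fun z : (T * U) * S => z.2 = f z.1.1).
    apply: (sa_pcomp (f := fun z : (T * U) * S => (z.1.1, z.2) : prod_space T S) hf).
    by move=> [i|i]; [exact: (polyf_co (inl (inl i) : idx (prod_space (prod_space T U) S)))|
      exact: (polyf_co (inr i : idx (prod_space (prod_space T U) S)))].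
  exact: sa_ext.
by apply: dmap_pmap => i; exact: (polyf_co (inr i : idx (prod_space T U))).
Qed.

Lemma dmap_fst T S U (f : T -> prod_space S U) : dmap f -> dmap (fun x => (f x).1).
Proof.
apply: (dmap_comp (g := fst)); apply: dmap_pmap => i.
exact: (polyf_co (inl i : idx (prod_space S U))).
Qed.

Lemma dmap_snd T S U (f : T -> prod_space S U) : dmap f -> dmap (fun x => (f x).2).
Proof.
apply: (dmap_comp (g := snd)); apply: dmap_pmap => i.
exact: (polyf_co (inr i : idx (prod_space S U))).
Qed.

Lemma sa_eq T S (f g : T -> S) : dmap f -> dmap g -> sa (fun x => f x = g x).
Proof.
move=> hf hg; exact: (sa_comp (dmap_id S) (dmap_pair hg hf)).
Qed.

Lemma sa_lt T (f g : T -> R) : dmap f -> dmap g -> sa (fun x => f x < g x).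
Proof.
move=> hf hg.
have h : sa (fun z : R * R => z.1 < z.2).
  apply: sa_lt_poly; first exact: (polyf_co (inl tt : idx (prod_space real_space real_space))).
  exact: (polyf_co (inr tt : idx (prod_space real_space real_space))).
exact: (sa_comp h (dmap_pair hf hg)).
Qed.

Lemma sa_le T (f g : T -> R) : dmap f -> dmap g -> sa (fun x => f x <= g x).
Proof.
move=> hf hg; apply: sa_ext (sa_not (sa_lt hg hf)) => x.
by rewrite leNgt; split=> /negP.
Qed.

Lemma dmap_add T (f g : T -> R) : dmap f -> dmap g -> dmap (fun x => f x + g x).
Proof.
move=> hf hg.
have h : dmap (fun z : R * R => z.1 + z.2).
  apply: dmap_poly; apply: polyf_add.
    exact: (polyf_co (inl tt : idx (prod_space real_space real_space))).
  exact: (polyf_co (inr tt : idx (prod_space real_space real_space))).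
exact: (dmap_comp h (dmap_pair hf hg)).
Qed.

Lemma dmap_mul T (f g : T -> R) : dmap f -> dmap g -> dmap (fun x => f x * g x).
Proof.
move=> hf hg.
have h : dmap (fun z : R * R => z.1 * z.2).
  apply: dmap_poly; apply: polyf_mul.
    exact: (polyf_co (inl tt : idx (prod_space real_space real_space))).
  exact: (polyf_co (inr tt : idx (prod_space real_space real_space))).
exact: (dmap_comp h (dmap_pair hf hg)).
Qed.

Lemma dmap_opp T (f : T -> R) : dmap f -> dmap (fun x => - f x).
Proof.
move=> hf; have -> : (fun x => - f x) = (fun x => -1 * f x).
  by apply/funext => x; rewrite mulN1r.
by apply: dmap_mul => //; apply: dmap_const.
Qed.

Lemma dmap_norm T (f : T -> R) : dmap f -> dmap (fun x => `|f x|).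
Proof.
apply: (dmap_comp (g := fun x : R => `|x|)).
have h : sa (fun z : R * R => (0 <= z.1 /\ z.2 = z.1) \/ (z.1 <= 0 /\ z.2 = - z.1)).
  have d1 : dmap (fun z : R * R => z.1) := dmap_fst (dmap_id _).
  have d2 : dmap (fun z : R * R => z.2) := dmap_snd (dmap_id _).
  apply: sa_or; apply: sa_and.
  - exact: (sa_le (dmap_const (prod_space real_space real_space) (0 : R)) d1).
  - exact: (sa_eq d2 d1).
  - exact: (sa_le d1 (dmap_const (prod_space real_space real_space) (0 : R))).
  - exact: (sa_eq d2 (dmap_opp d1)).
apply: sa_ext h => -[a b] /=; split=> [[[a0 ->]|[a0 ->]]|->].
- by rewrite ger0_norm.
- by rewrite ler0_norm.
- have [a0|/ltW a0] := leP 0 a; first by left; rewrite ger0_norm.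
  by right; rewrite ler0_norm.
Qed.

Lemma dmap_sum T (I : Type) (s : seq I) (P : pred I) (f : I -> T -> R) :
  (forall i, dmap (f i)) -> dmap (fun x => \sum_(i <- s | P i) f i x).
Proof.
move=> hf; elim: s => [|i s IH].
  have -> : (fun x : T => \sum_(i <- [::] | P i) f i x) = (fun=> 0).
    by apply/funext => x; rewrite big_nil.
  exact: dmap_const.
have -> : (fun x : T => \sum_(i <- i :: s | P i) f i x) =
  (if P i then (fun x => f i x + \sum_(i <- s | P i) f i x)
   else (fun x => \sum_(i <- s | P i) f i x)).
  by apply/funext => x; rewrite big_cons; case: ifP.
by case: ifP => // _; apply: dmap_add.
Qed.

Lemma dmap_entry T m n (f : T -> mx_space m n) i j :
  dmap f -> dmap (fun x => (f x : 'M[R]_(m, n)) i j).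
Proof.
apply: (dmap_comp (g := fun A : 'M[R]_(m, n) => A i j)).
by apply: dmap_poly; exact: (polyf_co ((i, j) : idx (mx_space m n))).
Qed.

Lemma dmap_mx T m n (f : T -> 'M[R]_(m, n)) :
  (forall i j, dmap (fun x => f x i j)) -> dmap f.
Proof. by move=> h; apply: dmap_coord => -[i j]; apply: h. Qed.

Lemma dmap_addmx T m n (f g : T -> 'M[R]_(m, n)) :
  dmap f -> dmap g -> dmap (fun x => f x + g x).
Proof.
move=> hf hg; apply: dmap_mx => i j.
have -> : (fun x => (f x + g x) i j) = (fun x => f x i j + g x i j).
  by apply/funext => x; rewrite mxE.
by apply: dmap_add; apply: dmap_entry.
Qed.

Lemma dmap_oppmx T m n (f : T -> 'M[R]_(m, n)) : dmap f -> dmap (fun x => - f x).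
Proof.
move=> hf; apply: dmap_mx => i j.
have -> : (fun x => (- f x) i j) = (fun x => - f x i j).
  by apply/funext => x; rewrite mxE.
by apply: dmap_opp; apply: dmap_entry.
Qed.

Lemma dmap_scalemx T m n (a : T -> R) (f : T -> 'M[R]_(m, n)) :
  dmap a -> dmap f -> dmap (fun x => a x *: f x).
Proof.
move=> ha hf; apply: dmap_mx => i j.
have -> : (fun x => (a x *: f x) i j) = (fun x => a x * f x i j).
  by apply/funext => x; rewrite mxE.
by apply: dmap_mul => //; apply: dmap_entry.
Qed.

Lemma dmap_mulmx T m n p (f : T -> 'M[R]_(m, n)) (g : T -> 'M[R]_(n, p)) :
  dmap f -> dmap g -> dmap (fun x => f x *m g x).
Proof.
move=> hf hg; apply: dmap_mx => i j.
have -> : (fun x => (f x *m g x) i j) = (fun x => \sum_k f x i k * g x k j).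
  by apply/funext => x; rewrite mxE.
by apply: dmap_sum => k; apply: dmap_mul; apply: dmap_entry.
Qed.

Lemma dmap_col_mx T m n p (f : T -> 'M[R]_(m, p)) (g : T -> 'M[R]_(n, p)) :
  dmap f -> dmap g -> dmap (fun x => col_mx (f x) (g x)).
Proof.
move=> hf hg; apply: dmap_mx => i j.
have -> : (fun x => (col_mx (f x) (g x)) i j) =
    match fintype.split i with inl k => (fun x => f x k j) | inr k => (fun x => g x k j) end.
  by apply/funext => x; rewrite mxE; case: (fintype.split i).
by case: (fintype.split i) => k; apply: dmap_entry.
Qed.

(** The definition used in the theorem is a disjunctive normal form, which [qf_dnf] supplies;
    elsewhere only [sa] is used. *)
Lemma sa_semialgebraic m n (S : set 'M[R]_(m, n)) : semialgebraic S <-> sa S.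
Proof.
split=> [[s ->]|/qf_dnf[s hs]].
  rewrite /sa; elim: s => [|a s IH] /=; first by apply: qf_ext (qf_not (@qf_true _ _)) => e /=; split.
  have hall : forall t : seq (pterm R ('I_m * 'I_n)), qf (fun e => all (fun g => 0 < peval g e) t).
    elim=> [|g t IHt] /=; first by apply: qf_ext (@qf_true _ _).
    by apply: qf_ext (qf_and (qf_pos g) IHt) => e; split=> [[-> ->]|/andP[-> ->]].
  apply: qf_ext (qf_or (qf_and (qf_eq0 a.1) (hall a.2)) IH) => e.
  have /= unE := @mx_unK m n e; rewrite /= unE.
  split=> [[[/eqP-> ->]|->]|/orP[/andP[/eqP? ?]|?]] //; first by rewrite orbT.
    by left.
  by right.
exists s; apply/seteqP; split=> A.
  by have := hs (co A); rewrite coK => -[h _] /h.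
by have := hs (co A); rewrite coK => -[_ h] /h.
Qed.

End Spaces.

(** * Uniform finiteness *)

Section UniformFiniteness.
Variable R : realType.

(** [P] keeps its truth value on every closed interval avoiding [z]. In this form, concatenation
    gives switch lists for Boolean combinations. *)
Definition switches_in (z : seq R) (P : R -> Prop) :=
  forall s s', s <= s' -> (forall w, w \in z -> ~ (s <= w <= s')) -> (P s <-> P s').

Section Univariate.
Variable V : Type.

(** Bounds the size (degree plus one) of [upoly e p] for all parameters [e] at once, which is the
    source of uniformity. *)
Fixpoint pdeg (p : pterm R (V + unit)) : nat :=
  match p with
  | PVar _ => 2
  | PConst _ => 1
  | PAdd p q | PMul p q => pdeg p + pdeg q
  end.

Fixpoint upoly (e : V -> R) (p : pterm R (V + unit)) : {poly R} :=
  match p with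
  | PVar (inl v) => (e v)%:P
  | PVar (inr _) => 'X
  | PConst c => c%:P
  | PAdd p q => upoly e p + upoly e q
  | PMul p q => upoly e p * upoly e q
  end.

Lemma horner_upoly e p s : (upoly e p).[s] = peval p (sumf e (fun=> s)).
Proof.
by elim: p => [[v|u]|c|p IHp q IHq|p IHp q IHq] /=;
  rewrite ?(hornerC, hornerX, hornerD, hornerM) ?IHp ?IHq.
Qed.

Lemma size_upoly e p : (size (upoly e p) <= pdeg p)%N.
Proof.
elim: p => [[v|u]|c|p IHp q IHq|p IHp q IHq] /=.
- by rewrite (leq_trans (size_polyC_leq1 _)).
- by rewrite size_polyX.
- exact: size_polyC_leq1.
- rewrite (leq_trans (size_polyD _ _)) // geq_max.
  by rewrite (leq_trans IHp (leq_addr _ _)) (leq_trans IHq (leq_addl _ _)).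
- rewrite (leq_trans (size_polyMleq _ _)) // (leq_trans (leq_pred _)) //.
  exact: leq_add.
Qed.

End Univariate.

(** By the intermediate value theorem a change of sign forces a root, so the roots serve as switch
    points. *)
Lemma switches_poly (q : {poly R}) :
  exists z : seq R, (size z <= size q)%N /\ switches_in z (fun s => 0 < q.[s]).
Proof.
have [->|q0] := eqVneq q 0; first by exists [::]; split=> // s s' _ _; rewrite !horner0.
have zP := polyrcf.roots_on_rootsR q0.
exists (polyrcf.rootsR q); split.
  apply/ltnW/max_poly_roots => //; last exact: polyrcf.uniq_roots.
  by apply/allP => x; rewrite -zP => /andP[].
move=> s s' ss' nz.
have ivt w : root q w -> s <= w <= s' -> False.
  by move=> qw; apply: nz; rewrite -zP in_itv /= qw.
split=> h.
- rewrite ltNge; apply/negP => h'.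
  have /(poly_ivt ss')[w] : (- q).[s] <= 0 <= (- q).[s'].
    by rewrite !hornerN oppr_le0 (ltW h) oppr_ge0.
  by move=> sw; rewrite rootN => /ivt /(_ sw).
- rewrite ltNge; apply/negP => h'.
  have /(poly_ivt ss')[w] : q.[s] <= 0 <= q.[s'] by rewrite h' ltW.
  by move=> sw /ivt /(_ sw).
Qed.

Lemma qf_switches V (P : (V + unit -> R) -> Prop) : qf P ->
  exists N, forall e : V -> R, exists z : seq R, (size z <= N)%N /\
    switches_in z (fun s => P (sumf e (fun=> s))).
Proof.
elim=> {P} [p|P _ [N hN]|P Q _ [N hN] _ [M hM]|P Q PQ _ [N hN]].
- exists (pdeg p) => e; have [z [sz hz]] := switches_poly (upoly e p).
  exists z; split; first exact: leq_trans sz (size_upoly _ _).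
  by move=> s s' ss' nz; have := hz s s' ss' nz; rewrite !horner_upoly.
- exists N => e; have [z [sz hz]] := hN e; exists z; split=> // s s' ss' nz.
  by have := hz s s' ss' nz; tauto.
- exists (N + M)%N => e; have [z [sz hz]] := hN e; have [z' [sz' hz']] := hM e.
  exists (z ++ z'); split; first by rewrite size_cat leq_add.
  move=> s s' ss' nz.
  have [||] := (hz s s' ss' _, hz' s s' ss' _).
  + by move=> w wz; apply: nz; rewrite mem_cat wz.
  + by move=> w wz; apply: nz; rewrite mem_cat wz orbT.
  tauto.
- exists N => e; have [z [sz hz]] := hN e; exists z; split=> // s s' ss' nz.
  by rewrite -!PQ; exact: hz.
Qed.

Lemma sa_switches (T : cspace R) (P : T * R -> Prop) : sa P ->
  exists N, forall x : T, exists z : seq R, (size z <= N)%N /\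
    switches_in z (fun s => P (x, s)).
Proof.
move=> /qf_switches[N hN]; exists N => x; have [z [sz hz]] := hN (co x).
exists z; split=> // s s' ss' nz; have := hz s s' ss' nz.
have h t : un (c := prod_space T (real_space R)) (sumf (co x) (fun=> t)) = (x, t).
  by rewrite /un /= /prod_un /= coK.
by rewrite !h.
Qed.

Lemma sa_switches1 (P : R -> Prop) : sa P -> exists z, switches_in z P.
Proof.
move=> hP.
have /sa_switches[N /(_ 0)[z [_ hz]]] : sa (fun z : R * R => P z.2).
  exact: sa_comp hP (dmap_snd (dmap_id _)).
by exists z.
Qed.

Lemma sa_eventually (P : R -> Prop) : sa P ->
  exists t, (forall s, t <= s -> P s) \/ (forall s, t <= s -> ~ P s).
Proof.
(* One plus the sum of the absolute values lies beyond every switch point. *)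
move=> /sa_switches1[z hz]; pose t := 1 + \sum_(w <- z) `|w|.
have tz w : w \in z -> w < t.
  move=> wz; rewrite /t ltr_pwDl // (le_trans (ler_norm w)) //.
  rewrite (big_rem w wz) /= lerDl; apply: sumr_ge0 => *; exact: normr_ge0.
have tP s : t <= s -> (P t <-> P s).
  by move=> ts; apply: hz => // w /tz; rewrite ltNge => /negbTE->.
exists t; have [Pt|nPt] := pselect (P t); [left|right] => s /tP; tauto.
Qed.

Lemma sa_right_germ (P : R -> Prop) (a : R) : sa P -> exists2 d, 0 < d &
  (forall s, a < s < a + d -> P s) \/ (forall s, a < s < a + d -> ~ P s).
Proof.
move=> /sa_switches1[z hz].
(* [d] is at most the distance from [a] to the next switch point on its right. *)
have [d d0 dz] : exists2 d, 0 < d & forall w, w \in z -> a < w -> a + d <= w.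
  elim: z {hz} => [|w z [d d0 dz]]; first by exists 1.
  have [aw|wa] := ltP a w; last first.
    exists d => // w'; rewrite inE => /predU1P[->|//]; last exact: dz.
    by rewrite ltNge wa.
  exists (Num.min d (w - a)); first by rewrite lt_min d0 subr_gt0.
  move=> w'; rewrite inE => /predU1P[-> _|w'z aw'].
    by rewrite -lerBrDl ge_min lexx orbT.
  by rewrite (le_trans _ (dz _ w'z aw')) // lerD2l ge_min lexx.
have PP s s' : a < s -> s < a + d -> a < s' -> s' < a + d -> P s -> P s'.
  move=> h1 h2 h3 h4.
  have key u u' : a < u -> u' < a + d -> u <= u' -> (P u <-> P u').
    move=> au ud uu'; apply: hz => // w wz /andP[uw wu].
    have := dz w wz (lt_le_trans au uw); lra.
  have [ss'|/ltW ss'] := leP s s'; last by case: (key s' s h3 h2 ss').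
  by case: (key s s' h1 h4 ss').
exists d => //.
have [Pm|nPm] := pselect (P (a + d / 2)); [left|right] => s /andP[h1 h2].
  by apply: PP Pm => //; lra.
by move=> Ps; apply: nPm; apply: PP Ps => //; lra.
Qed.

(** Pigeonhole: the N + 1 closed intervals of length [d] start at even multiples of [d], hence are
    pairwise disjoint, and N points cannot meet them all. *)
Lemma disjoint_interval (z : seq R) N (d : R) : (size z <= N)%N -> 0 < d ->
  exists k : 'I_N.+1, forall w, w \in z -> ~ (d * (k * 2)%:R <= w <= d * (k * 2)%:R + d).
Proof.
move=> zN d0; apply: contrapT => hn.
have /choice[f hf] : forall k : 'I_N.+1, exists w, w \in z /\
    d * (k * 2)%:R <= w <= d * (k * 2)%:R + d.
  move=> k; apply: contrapT => nw; apply: hn.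
  by exists k => w wz h; apply: nw; exists w.
have finj : injective f.
  suff h (k l : 'I_N.+1) : (k < l)%N -> f k <> f l.
    move=> k l fkl; apply/eqP/contraT; rewrite neq_ltn.
    by case/orP => /h; rewrite fkl.
  move=> kl fkl; have [_ /andP[_ h1]] := hf k; have [_ /andP[h2 _]] := hf l.
  have : d * (l * 2)%:R <= d * (k * 2)%:R + d by rewrite (le_trans h2) -?fkl.
  apply/negP; rewrite -ltNge -{2}[d]mulr1 -mulrDr ltr_pM2l // natr1 ltr_nat.
  by move: kl; lia.
have : (size (codom f) <= size z)%N.
  apply: uniq_leq_size; first by rewrite map_inj_uniq // enum_uniq.
  by move=> w /codomP[k ->]; case: (hf k).
by rewrite size_codom card_ord leqNgt ltnS zN.
Qed.

(** * Total variation bounded by level crossings *)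

Section BoundedVariation.
Variables (K : nat) (t u : nat -> R) (a b : R) (N : nat).
Hypothesis tlt : forall i, (i < K)%N -> t i < t i.+1.
Hypothesis uab : forall i, (i <= K)%N -> a <= u i <= b.
Hypothesis ucross : forall c, exists z : seq R, (size z <= N)%N /\
  forall i, (i < K)%N -> (forall w, w \in z -> ~ (t i <= w <= t i.+1)) ->
    (c < u i) = (c < u i.+1).

(** A point lies in two of the intervals when it is a common endpoint. The function [g] has values
    in 0, 1, 2 and drops by at least one across each interval containing [w], so telescoping bounds
    the count. *)
Let visits (w : R) : \sum_(i < K) (t i <= w <= t i.+1)%R%:R <= 2 :> R.
Proof.
pose g i : R := (t i <= w)%R%:R + (t i < w)%R%:R.
have h i : (i < K)%N -> (t i <= w <= t i.+1)%R%:R <= g i - g i.+1.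
  move=> /tlt; rewrite /g.
  by case: (ltgtP (t i) w) => h1; case: (ltgtP (t i.+1) w) => h2 /=; lra.
have : \sum_(i < K) (t i <= w <= t i.+1)%R%:R <= \sum_(i < K) (g i - g i.+1).
  by apply: ler_sum => i _; apply: h.
move=> /le_trans; apply; rewrite -(big_mkord xpredT (fun i => g i - g i.+1)).
have -> : \sum_(0 <= i < K) (g i - g i.+1) = g 0 - g K.
  rewrite -[RHS]opprB -(telescope_sumr g (leq0n K)) -sumrN.
  by apply: eq_bigr => i _; rewrite opprB.
by rewrite /g; case: (t 0%N <= w)%R; case: (t 0%N < w)%R; case: (t K <= w)%R; case: (t K < w)%R => /=; lra.
Qed.

(** Each change of side of the level [c] is charged to a point of [z] in the corresponding interval;
    by [visits] a point is charged at most twice. *)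
Let crossings (c : R) :
  \sum_(i < K) `|(c < u i.+1)%R%:R - (c < u i)%R%:R| <= (2 * N)%:R :> R.
Proof.
have [z [zN hz]] := ucross c.
apply: (@le_trans _ _ (\sum_(i < K) \sum_(w <- z) (t i <= w <= t i.+1)%R%:R)).
  apply: ler_sum => i _.
  have [h|h] := pselect (forall w, w \in z -> ~ (t i <= w <= t i.+1)).
    by rewrite (hz i (ltn_ord i) h) subrr normr0 sumr_ge0.
  have [w [wz hw]] : exists w, w \in z /\ t i <= w <= t i.+1.
    by apply: contrapT => nw; apply: h => w wz hw; apply: nw; exists w.
  rewrite (big_rem w wz) /= hw.
  apply: (@le_trans _ _ 1); last by rewrite lerDl sumr_ge0.
  by case: (c < u i.+1)%R; case: (c < u i)%R => /=; rewrite ?subrr ?subr0 ?sub0r ?normrN ?normr0 ?normr1.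
rewrite exchange_big /= (@le_trans _ _ (\sum_(w <- z) 2)) //.
  by apply: ler_sum => w _; exact: visits.
rewrite big_const_seq count_predT iter_addr_0 -mulrnA ler_nat.
by rewrite leq_mul2l zN.
Qed.

(** A finite layer-cake sum: if the levels [c :: s] increase and contain [x], it equals [x - c], and
    it depends on [x] only through comparisons with the levels. *)
Fixpoint levels (c : R) (s : seq R) (x : R) : R :=
  if s is c' :: s' then (c' - c) * (c < x)%R%:R + levels c' s' x else 0.

Let levels_low c s x : path <%R c s -> x <= c -> levels c s x = 0.
Proof.
elim: s c => //= c' s IH c /andP[cc' ps] xc; rewrite ltNge xc mulr0 add0r.
by apply: IH => //; apply: le_trans xc (ltW cc').
Qed.

Let levelsE c s x : path <%R c s -> x \in c :: s -> levels c s x = x - c.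
Proof.
elim: s c => [|c' s IH] c /=; first by rewrite inE => _ /eqP->; rewrite subrr.
move=> /andP[cc' ps]; rewrite inE => /predU1P[->|xs].
  by rewrite ltxx mulr0 add0r subrr (levels_low ps (ltW cc')).
have c'x : c' <= x.
  move: xs; rewrite inE => /predU1P[->//|xs].
  by have /allP/(_ x xs)/ltW := order_path_min lt_trans ps.
by rewrite (lt_le_trans cc' c'x) mulr1 IH //; ring.
Qed.

Let levels_var c s : path <%R c s ->
  \sum_(i < K) `|levels c s (u i.+1) - levels c s (u i)| <= (2 * N)%:R * (last c s - c).
Proof.
elim: s c => [|c' s IH] c /=.
  by move=> _; rewrite big1 ?subrr ?mulr0 // => i _; rewrite normr0.
move=> /andP[cc' /IH{}IH].
apply: (@le_trans _ _ (\sum_(i < K) ((c' - c) * `|(c < u i.+1)%R%:R - (c < u i)%R%:R|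
   + `|levels c' s (u i.+1) - levels c' s (u i)|))).
  apply: ler_sum => i _.
  have -> : forall (p q r l m : R), p * q + l - (p * r + m) = p * (q - r) + (l - m) by move=> *; ring.
  rewrite (le_trans (ler_normD _ _)) // lerD2r normrM ger0_norm ?lexx //.
  by rewrite subr_ge0 ltW.
rewrite big_split /= -mulr_sumr.
have -> : (2 * N)%:R * (last c' s - c) =
  (c' - c) * (2 * N)%:R + (2 * N)%:R * (last c' s - c') by ring.
by apply: lerD => //; apply: ler_wpM2l; [rewrite subr_ge0 ltW|exact: crossings].
Qed.

(* Level sets: the variation is the integral over c of the number of crossings of c. *)
Lemma variation_le_crossings : \sum_(i < K) `|u i.+1 - u i| <= (2 * N)%:R * (b - a).
Proof.
(* The levels are the values taken by [u], so that [levels] recovers every [u i] exactly, up to a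
   common constant. *)
pose vals := sort <=%R (undup [seq u i | i <- iota 0 K.+1]).
have mem i : (i <= K)%N -> u i \in vals.
  by move=> iK; rewrite mem_sort mem_undup map_f // mem_iota.
have memab x : x \in vals -> a <= x <= b.
  rewrite mem_sort mem_undup => /mapP[i]; rewrite mem_iota add0n ltnS => /andP[_ iK] ->.
  exact: uab.
have : sorted <%R vals by rewrite sort_lt_sorted undup_uniq.
case E : vals mem memab => [|c s] mem memab /= ps; first by have := mem 0%N isT.
apply: (@le_trans _ _ (\sum_(i < K) `|levels c s (u i.+1) - levels c s (u i)|)).
  apply: ler_sum => i _.
  by rewrite !levelsE ?mem // ?(ltnW (ltn_ord i)) // opprB addrA subrK.
rewrite (le_trans (levels_var ps)) // ler_wpM2l //.
have /memab/andP[_ h1] := mem_last c s; have /memab/andP[h2 _] := mem_head c s.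
by lra.
Qed.

End BoundedVariation.

End UniformFiniteness.

(** * Definable choice *)

Lemma sa_app2 (R : realType) (U T S : cspace R) (P : T -> S -> Prop) (f : U -> T) (g : U -> S) :
  sa (fun z : T * S => P z.1 z.2) -> dmap f -> dmap g -> sa (fun u => P (f u) (g u)).
Proof. by move=> hP hf hg; exact: (sa_comp hP (dmap_pair hf hg)). Qed.

(** Follows the syntax of a map or predicate and leaves the subgoals about abstract ones. Sums and
    opposites are tried over the reals first, then over matrices. *)
Ltac definable := repeat (lazy beta; lazymatch goal with
  | |- dmap (fun x => x) => exact: dmap_id
  | |- dmap (fun x => fst _) => apply: dmap_fst
  | |- dmap (fun x => snd _) => apply: dmap_snd
  | |- dmap fst => exact: (dmap_fst (dmap_id _))
  | |- dmap snd => exact: (dmap_snd (dmap_id _))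
  | |- dmap (fun x => (_, _)) => apply: dmap_pair
  | |- dmap (fun x => fun_of_matrix _ _ _) => apply: dmap_entry
  | |- dmap (fun x => mulmx _ _) => apply: dmap_mulmx
  | |- dmap (fun x => col_mx _ _) => apply: dmap_col_mx
  | |- dmap (fun x => GRing.mul (@?f x) (@?g x)) => refine (@dmap_mul _ _ f g _ _)
  | |- dmap (fun x => GRing.scale _ _) => apply: dmap_scalemx
  | |- dmap (fun x => Num.norm _) => apply: dmap_norm
  | |- dmap (fun x => bigop.body _ _ _) => apply: dmap_sum => ?
  | |- dmap (fun x => Algebra.add (@?f x) (@?g x)) =>
      first [refine (@dmap_add _ _ f g _ _) | refine (@dmap_addmx _ _ _ _ f g _ _)]
  | |- dmap (fun x => Algebra.opp (@?f x)) =>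
      first [refine (@dmap_opp _ _ f _) | refine (@dmap_oppmx _ _ _ _ f _)]
  | |- dmap _ => exact: dmap_const
  | |- sa (fun x => ex _) => apply: sa_ex
  | |- sa (fun x => _ /\ _) => apply: sa_and
  | |- sa (fun x => _ \/ _) => apply: sa_or
  | |- sa (fun x => ~ _) => apply: sa_not
  | |- sa (fun x => is_true (_ && _)) => apply: (sa_ext (fun x => rwP andP))
  | |- sa (fun x => is_true (Order.lt _ _)) => apply: sa_lt
  | |- sa (fun x => is_true (Order.le _ _)) => apply: sa_le
  | |- sa (fun x => eq _ _) => apply: sa_eq
  | |- sa (fun x => forall y, _) => first [apply: sa_imp | apply: sa_all]
  end).

Section Choice.
Variable R : realType.

Section Select.
Variable P : R -> Prop.

Definition least z := P z /\ forall s, P s -> z <= s.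
Definition glb a := (forall s, P s -> a <= s) /\ forall b, (forall s, P s -> b <= s) -> b <= a.
Definition filled a d := (0 < d /\ d <= 1) /\ forall s, a < s /\ s < a + d -> P s.
Definition fills a d := filled a d /\ forall d', filled a d' -> d' <= d.
(* The least element of P if there is one; otherwise the midpoint of ]a, a + d[, where a is the
   infimum of P and d <= 1 is maximal with ]a, a + d[ contained in P. *)
Definition select z :=
  ((exists s, P s) /\ (least z \/ (~ (exists w, least w) /\
    exists a, exists d, glb a /\ (fills a d /\ z = a + d * 2^-1)))) \/
  (~ (exists s, P s) /\ z = 0).

Lemma select_unique z z' : select z -> select z' -> z = z'.
Proof.
have le_anti2 (x y : R) : x <= y -> y <= x -> x = y.
  by move=> h1 h2; apply/eqP; rewrite eq_le h1 h2.
move=> [[eP [lz|[nl [a [d [[ga1 ga2] [[fd md] ->]]]]]]]|[nP ->]]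
  [[eP' [lz'|[nl' [a' [d' [[ga1' ga2'] [[fd' md'] ->]]]]]]]|[nP' ->]] //; try by exfalso; eauto.
- by case: lz => Pz hz; case: lz' => Pz' hz'; apply: le_anti2; [exact: hz|exact: hz'].
- have aa : a = a' by apply: le_anti2; [exact: ga2'|exact: ga2].
  by subst a'; rewrite (le_anti2 d d') //; [exact: md'|exact: md].
Qed.

Lemma select_in z : (exists s, P s) -> select z -> P z.
Proof.
move=> eP [[_ [[]//|[_ [a [d [_ [[[/andP dd hd] _] ->]]]]]]]|[]//].
by apply: hd; move/andP: dd; lra.
Qed.

Lemma select_ex : sa P -> (exists b, forall s, P s -> b <= s) -> exists z, select z.
Proof.
move=> hP [b hb].
have [eP|nP] := pselect (exists s, P s); last by exists 0; right.
have [[w hw]|nl] := pselect (exists w, least w); first by exists w; left; split=> //; left.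
pose E := [set s | P s].
have hE : has_inf E by split=> //; exists b.
have gE : glb (inf E).
  split=> [s Ps|b' hb']; first by apply: ge_inf => //; exists b.
  by apply: lb_le_inf => //; case: hE.
(* Without a least element, points of [P] accumulate at the infimum from the right, so the germ
   there must lie in [P]. *)
have [d0 d0p [hd|hd]] := sa_right_germ (inf E) hP; last first.
  have [s Ps sd] := inf_adherent d0p hE.
  exfalso; apply: (hd s) => //; rewrite sd andbT lt_neqAle gE.1 // andbT.
  apply/eqP => Es; apply: nl; exists s; split=> // s' Ps'.
  by rewrite -Es; exact: gE.1.
pose D := [set d | filled (inf E) d].
have D0 : D (Num.min d0 1).
  split; first by rewrite lt_min d0p ltr01 ge_min lexx orbT.
  move=> s [h1 h2]; apply: hd; rewrite h1 /= (lt_le_trans h2) //.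
  by rewrite lerD2l ge_min lexx.
have hD : has_sup D by split; [exists (Num.min d0 1)|exists 1 => d [[]]].
exists (inf E + sup D * 2^-1); left; split=> //; right; split=> //.
exists (inf E), (sup D); split=> //; split=> //; split; last first.
  by move=> d' hd'; apply: sup_upper_bound.
split.
  split; last by apply: ge_sup => [|d [[]]]; first by exists (Num.min d0 1).
  by case: (D0) => -[h _] _; apply: lt_le_trans h _; exact: sup_upper_bound.
(* The supremum is attained: [s] already lies below [inf E + d] for some admissible [d]. *)
move=> s [h1 h2]; have e0 : 0 < inf E + sup D - s by lra.
have [d [_ hd'] hds] := sup_adherent e0 hD.
by apply: hd'; split=> //; lra.
Qed.

End Select.

(** The rule [select] is first-order and single-valued, so the function it defines has a
    semialgebraic graph; the lower bound makes the infimum exist. *)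
Lemma definable_choice1 (T : cspace R) (P : T -> R -> Prop) :
  sa (fun z : T * R => P z.1 z.2) ->
  (forall x, exists b, forall s, P x s -> b <= s) ->
  exists f : T -> R, dmap f /\ forall x, (exists s, P x s) -> P x (f x).
Proof.
move=> hP hb.
have /choice[f hf] : forall x, exists z, select (P x) z.
  move=> x; apply: select_ex => //.
  exact: (sa_app2 hP (dmap_const (real_space R) x) (dmap_id _)).
exists f; split; last by move=> x ex; exact: select_in (hf x).
have : sa (fun z : T * R => select (P z.1) z.2).
  by rewrite /select /least /glb /fills /filled; definable; apply: (sa_app2 hP); definable.
apply: sa_ext => -[x z] /=; split=> [h|->//].
exact: select_unique (hf x).
Qed.

(** Coordinates are chosen one at a time: the first among the values that extend to a solution, the
    others by induction with that value fixed. *)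
Lemma definable_choice (T : cspace R) k (P : T -> 'cV[R]_k -> Prop) :
  sa (fun z : T * 'cV[R]_k => P z.1 z.2) ->
  (forall x, exists b, forall v, P x v -> forall i, b <= v i 0) ->
  exists f : T -> 'cV[R]_k, dmap f /\ forall x, (exists v, P x v) -> P x (f x).
Proof.
elim: k P => [|k IH] P hP hb.
  exists (fun=> 0); split; first exact: dmap_const.
  by move=> x [v]; rewrite (flatmx0 v).
pose cons (s : R) (v : 'cV[R]_k) : 'cV[R]_k.+1 := col_mx (const_mx s : 'M[R]_(1, 1)) v.
have dcons (U : cspace R) (f : U -> R) (g : U -> 'cV[R]_k) :
    dmap f -> dmap g -> dmap (fun u => cons (f u) (g u)).
  move=> hf hg; apply: (dmap_col_mx (f := fun u => const_mx (f u) : 'M[R]_(1, 1))) => //.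
  apply: dmap_mx => i j.
  by have -> : (fun x => (const_mx (f x) : 'M[R]_(1, 1)) i j) = f by apply/funext => x; rewrite mxE.
have consE (v : 'cV[R]_k.+1) : v = cons (v 0 0) (dsubmx (v : 'cV[R]_(1 + k))).
  rewrite /cons; suff -> : const_mx (v 0 0) = usubmx (v : 'cV[R]_(1 + k)) by rewrite vsubmxK.
  by apply/matrixP => i j; rewrite !mxE !ord1; congr (v _ _); apply: val_inj.
have [g [dg hg]] : exists g : T -> R, dmap g /\
    forall x, (exists s, exists v, P x (cons s v)) -> exists v, P x (cons (g x) v).
  apply: (definable_choice1 (P := fun x s => exists v, P x (cons s v))).
    definable; apply: (sa_app2 hP); first by definable.
    by apply: dcons; definable.
  move=> x; have [b hbx] := hb x; exists b => s [v /hbx hv].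
  by have := hv (lshift k (0 : 'I_1)); rewrite /cons (@col_mxEu _ 1 k 1) mxE.
have [h [dh hh]] : exists h : T -> 'cV[R]_k, dmap h /\
    forall x, (exists v, P x (cons (g x) v)) -> P x (cons (g x) (h x)).
  apply: (IH (fun x v => P x (cons (g x) v))).
    apply: (sa_app2 hP); first by definable.
    by apply: dcons; [apply: (dmap_comp dg); definable|definable].
  move=> x; have [b hbx] := hb x; exists b => v /hbx hv i.
  by have := hv (rshift 1 i); rewrite /cons (@col_mxEd _ 1 k 1).
exists (fun x => cons (g x) (h x)); split; first exact: dcons.
move=> x [v Pv]; apply: hh; apply: hg.
by exists (v 0 0), (dsubmx (v : 'cV[R]_(1 + k))); rewrite -consE.
Qed.

End Choice.

(** * Norms, open sets and minima *)

Section Topology.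
Variable R : realType.

(** The l1 norm: moving one coordinate towards 0 by at most its size lowers the norm by exactly that
    amount, as [N1_shrink] exploits. *)
Definition N1 k (v : 'cV[R]_k) : R := \sum_i `|v i 0|.

Lemma N1_ge0 k (v : 'cV[R]_k) : 0 <= N1 v.
Proof. by apply: sumr_ge0. Qed.

Lemma N1D k (u v : 'cV[R]_k) : N1 (u + v) <= N1 u + N1 v.
Proof. by rewrite /N1 -big_split; apply: ler_sum => i _; rewrite mxE ler_normD. Qed.

Lemma N1N k (v : 'cV[R]_k) : N1 (- v) = N1 v.
Proof. by apply: eq_bigr => i _; rewrite mxE normrN. Qed.

Lemma N1B k (u v : 'cV[R]_k) : N1 (u - v) = N1 (v - u).
Proof. by rewrite -N1N opprB. Qed.

Lemma N1_0 k : N1 (0 : 'cV[R]_k) = 0.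
Proof. by rewrite /N1 big1 // => i _; rewrite mxE normr0. Qed.

Lemma N1_triangle k (u v w : 'cV[R]_k) : N1 (u - w) <= N1 (u - v) + N1 (v - w).
Proof. by have := N1D (u - v) (v - w); rewrite addrA subrK. Qed.

Lemma N1_coord k (v : 'cV[R]_k) i : `|v i 0| <= N1 v.
Proof. by rewrite /N1 (bigD1 i) //= lerDl sumr_ge0. Qed.

Lemma N1_eq0 k (v : 'cV[R]_k) : N1 v = 0 -> v = 0.
Proof.
move=> v0; apply/matrixP => i j; rewrite !mxE !ord1; apply/eqP.
by rewrite -normr_le0 -v0; exact: N1_coord.
Qed.

Lemma N1_lip k (u v : 'cV[R]_k) : `|N1 u - N1 v| <= N1 (u - v).
Proof.
have := N1D (u - v) v; have := N1D (v - u) u; rewrite !subrK (N1B v u).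
by rewrite ler_norml; lra.
Qed.

Lemma N1_mulmx k l (F : 'M[R]_(l, k)) : exists2 B, 0 < B & forall v, N1 (F *m v) <= B * N1 v.
Proof.
exists (1 + \sum_i \sum_j `|F i j|).
  by rewrite ltr_pwDl // sumr_ge0 // => i _; rewrite sumr_ge0.
move=> v; rewrite mulrDl mul1r; apply: (@le_trans _ _ ((\sum_i \sum_j `|F i j|) * N1 v)); last first.
  by rewrite lerDr N1_ge0.
rewrite {1}/N1 mulr_suml; apply: ler_sum => i _; rewrite mxE mulr_suml.
apply: le_trans (ler_norm_sum _ _ _) _; apply: ler_sum => j _.
by rewrite normrM ler_wpM2l //; exact: N1_coord.
Qed.

Lemma dmap_N1 (T : cspace R) k (f : T -> 'cV[R]_k) : dmap f -> dmap (fun x => N1 (f x)).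
Proof. by move=> hf; rewrite /N1; definable. Qed.

Lemma nbhs_N1 k (x : 'cV[R]_k) (A : set 'cV[R]_k) :
  nbhs x A <-> exists2 e, 0 < e & forall x', N1 (x' - x) < e -> A x'.
Proof.
split=> [/nbhs_ballP[e /= e0 h]|[e e0 h]].
  exists e => // x' h'; apply: h; split=> // i j; rewrite ord1.
  rewrite /ball /= distrC; apply: le_lt_trans h'.
  by have := N1_coord (x' - x) i; rewrite !mxE.
(* Dividing by [k.+1] covers dimension 0 and keeps the sum of [k] terms strictly below [e]. *)
apply/nbhs_ballP; exists (e / k.+1%:R) => /=; first by rewrite divr_gt0.
move=> x' [_ h']; apply: h.
apply: (@le_lt_trans _ _ (\sum_(i < k) e / k.+1%:R)).
  apply: ler_sum => i _; have := h' i 0; rewrite /ball /= distrC => /ltW.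
  by rewrite !mxE.
rewrite big_const_ord iter_addr_0 -[X in X < _]mulr_natr -mulrA gtr_pMr // mulrC ltr_pdivrMr //.
by rewrite mul1r ltr_nat.
Qed.

Lemma closed_N1 k (A : set 'cV[R]_k) : closed A <->
  forall y, (forall e, 0 < e -> exists a, A a /\ N1 (a - y) < e) -> A y.
Proof.
split=> [cA y hy|h y hy].
  apply: cA => B /nbhs_N1[e e0 hB]; have [a [Aa ae]] := hy e e0.
  by exists a; split=> //; exact: hB.
apply: h => e e0.
have nb : nbhs y [set a | N1 (a - y) < e] by apply/nbhs_N1; exists e.
by have [a [Aa Ba]] := hy _ nb; exists a.
Qed.

Lemma nbhs_mx k l (F : 'M[R]_(k, l)) (A : set 'M[R]_(k, l)) :
  nbhs F A <-> exists2 e, 0 < e & forall F' : 'M[R]_(k, l), (forall i j, `|F' i j - F i j| < e) -> A F'.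
Proof.
split=> [/nbhs_ballP[e /= e0 h]|[e e0 h]].
  by exists e => // F' h'; apply: h; split=> // i j; rewrite /ball /= distrC.
apply/nbhs_ballP; exists e => //= F' [_ h']; apply: h => i j.
by have := h' i j; rewrite /ball /= distrC.
Qed.

Lemma sa_interior k l (A : set 'M[R]_(k, l)) : sa A -> sa A°.
Proof.
move=> hA.
have : sa (fun F : 'M[R]_(k, l) => exists e : R, 0 < e /\ forall F' : 'M[R]_(k, l),
    (forall ij : 'I_k * 'I_l, `|F' ij.1 ij.2 - F ij.1 ij.2| < e) -> A F').
  definable; first by apply: sa_fin => ij; definable.
  by apply: (sa_comp hA); definable.
apply: sa_ext => F; split=> [[e [e0 h]]|/nbhs_mx[e e0 h]].
  by apply/nbhs_mx; exists e => // F' h'; apply: h => -[].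
by exists e; split=> // F' h'; apply: h => i j; exact: (h' (i, j)).
Qed.

Lemma peval_continuous k l (p : pterm R ('I_k * 'I_l)) :
  continuous (fun A : 'M[R]_(k, l) => peval p (fun ij => A ij.1 ij.2)).
Proof.
elim: p => [ij|c|p IHp q IHq|p IHp q IHq] A /=.
- exact: coord_continuous.
- exact: cst_continuous.
- exact: (cvgD (IHp A) (IHq A)).
- exact: (cvgM (IHp A) (IHq A)).
Qed.

(** Induction on the predicate. For an atom, the open set where the polynomial is positive either
    meets [O], and the intersection serves, or misses it, and [O] itself serves; a conjunction
    shrinks the open set twice. *)
Lemma sa_decided k l (S O : set 'M[R]_(k, l)) : sa S -> open O -> O !=set0 ->
  exists V, [/\ open V, V !=set0, V `<=` O & V `<=` S \/ V `<=` ~` S].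
Proof.
suff key (P : ('I_k * 'I_l -> R) -> Prop) : qf P -> forall O : set 'M[R]_(k, l), open O -> O !=set0 ->
    exists V, [/\ open V, V !=set0, V `<=` O &
      (forall A, V A -> P (co A)) \/ (forall A, V A -> ~ P (co A))].
  move=> hS oO nO; have [V [h1 h2 h3 h4]] := key _ hS O oO nO; exists V; split=> //.
  by case: h4 => h4; [left|right] => A /h4; rewrite coK.
elim=> {P} [p|P _ IH|P Q _ IHP _ IHQ|P Q PQ _ IH] {}O oO nO.
- pose f (A : 'M[R]_(k, l)) := peval p (co A).
  have cf : continuous f by exact: peval_continuous.
  have oP : open (f @^-1` [set x | 0 < x]).
    by apply: open_comp; [move=> A _; exact: cf|exact: open_gt].
  have [[A [OA fA]]|nA] := pselect ((O `&` f @^-1` [set x | 0 < x]) !=set0).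
    exists (O `&` f @^-1` [set x | 0 < x]); split; [exact: openI|by exists A|exact: subIsetl|].
    by left=> B [].
  exists O; split=> //; right=> A OA fA; apply: nA; exists A; split=> //.
- have [V [h1 h2 h3 h4]] := IH O oO nO; exists V; split=> //.
  by case: h4 => h4; [right|left] => A OA; [move/(_ (h4 A OA))|exact: h4].
- have [V [h1 h2 h3 h4]] := IHP O oO nO.
  have [V' [h1' h2' h3' h4']] := IHQ V h1 h2; exists V'; split=> //.
    exact: subset_trans h3' h3.
  case: h4 => h4; last by right=> A /h3' /h4 h []/h.
  case: h4' => h4'; last by right=> A /h4' h [_]/h.
  by left=> A OA; split; [apply/h4/h3'|exact: h4'].
- have [V [h1 h2 h3 h4]] := IH O oO nO; exists V; split=> //.
  by case: h4 => h4; [left|right] => A /h4; rewrite PQ.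
Qed.

HB.instance Definition _ k l := Uniform_isComplete.Build 'M[R]_(k, l) (@mx_complete R k l).

(** Otherwise, by [sa_decided], the interior of each complement would be dense in [O], and Baire's
    theorem would give a point of [O] in no [S i]. *)
Lemma sa_cover k l (J : countType) (S : J -> set 'M[R]_(k, l)) (O : set 'M[R]_(k, l)) :
  (forall i, sa (S i)) -> open O -> O !=set0 -> (forall F, O F -> exists i, S i F) ->
  exists i, exists V, [/\ open V, V !=set0 & V `<=` S i].
Proof.
move=> hS oO nO cover; apply: contrapT => hn.
(* The interior of the complement of [O] is added to make [W j] dense everywhere; numbers coding no
   index get the whole space. *)
pose W (j : nat) : set 'M[R]_(k, l) :=
  if unpickle j is Some i then (~` S i)° `|` (~` O)° else setT.
have /(@Baire R 'M[R]_(k, l)) dW : forall j, open (W j) /\ dense (W j).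
  move=> j; rewrite /W; case: (unpickle j) => [i|]; last first.
    by split; [exact: openT|move=> B nB oB; rewrite setIT].
  split; first by apply: openU; exact: open_interior.
  move=> B nB oB.
  have [nBO|BO] := pselect ((B `&` O) !=set0); last first.
    case: nB => F BF; exists F; split=> //; right.
    apply: (filterS _ (open_nbhs_nbhs (conj oB BF))) => F' BF' OF'.
    by apply: BO; exists F'.
  have [V [h1 h2 h3 [h4|h4]]] := sa_decided (hS i) (openI oB oO) nBO.
    by exfalso; apply: hn; exists i, V.
  case: (h2) => F O1F; exists F; split; first by case: (h3 F O1F).
  by left; apply: (filterS h4); exact: (open_nbhs_nbhs (conj h1 O1F)).
have [F [OF WF]] := dW O nO oO.
have [i SiF] := cover F OF.
have := WF (pickle i) I; rewrite /W pickleK => -[/interior_subset|/interior_subset]; exact.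
Qed.

Section Minimum.
Variables (n : nat) (X : set 'cV[R]_n) (psi : 'cV[R]_n -> R).
Hypothesis cX : closed X.
Hypothesis cpsi : forall x, X x -> forall e, 0 < e -> exists2 d, 0 < d &
  forall x', X x' -> N1 (x' - x) < d -> `|psi x' - psi x| < e.

Lemma bounded_minimum x0 r : X x0 -> 0 <= r -> exists x, [/\ X x, N1 (x - x0) <= r &
  forall x', X x' -> N1 (x' - x0) <= r -> psi x <= psi x'].
Proof.
move=> Xx0 r0; pose K := [set x | X x /\ N1 (x - x0) <= r].
have cK : closed K.
  apply/closed_N1 => y hy; split.
    move/closed_N1: cX; apply=> e /hy[a [[Xa _] ae]]; by exists a.
  apply/ler_addgt0Pr => e e0; have [a [[_ h1] h2]] := hy e e0.
  by have := N1_triangle y a x0; rewrite (N1B y a); lra.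
(* Compactness is obtained for row vectors and carried over by transposition. *)
have trc p q : continuous (trmx : 'M[R]_(p, q) -> 'M[R]_(q, p)).
  move=> A B /nbhs_mx[e e0 h]; apply/nbhs_mx; exists e => // A' h'; apply: h => i j.
  by rewrite !mxE.
have compK : compact K.
  have -> : K = trmx @` [set v : 'rV[R]_n | K v^T].
    apply/seteqP; split=> [x Kx|x [v Kv <-]//]; exists x^T => //=; by rewrite trmxK.
  apply: continuous_compact; first by apply: continuous_subspaceT; exact: trc.
  apply: bounded_closed_compact; last first.
    by apply: (closed_comp (f := trmx)) => // v _; exact: trc.
  exists (N1 x0 + r); split; first exact: num_real.
  move=> M hM v [_ hv]; apply: le_trans (ltW hM).
  rewrite /Num.norm /= mx_normrE; apply: bigmax_le; first by rewrite addr_ge0 // N1_ge0.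
  move=> [i j] _ /=; rewrite ord1.
  have := N1D (v^T - x0) x0; rewrite subrK => h; have := N1_coord v^T j.
  by rewrite mxE; lra.
have [||c cin hc] := @compact_EVT_min _ R psi K _ compK; first by exists x0; split=> //; rewrite subrr N1_0.
  apply/subspace_continuousP => x [Xx _]; apply/cvgrPdist_lt => e e0.
  have [d d0 hd] := cpsi Xx e0.
  rewrite near_withinE; near=> x'; move=> [Xx' _]; rewrite distrC; apply: hd => //.
  near: x'; apply/nbhs_N1; by exists d.
move: cin; rewrite inE => -[Xc rc]; exists c; split=> // x' Xx' rx'.
by apply: hc; rewrite inE.
Unshelve. all: by end_near. Qed.

End Minimum.

Lemma within_N1 n m (X : set 'cV[R]_n) (G : 'cV[R]_n -> 'cV[R]_m) :
  {within X, continuous G} -> forall x, X x -> forall e, 0 < e -> exists2 d, 0 < d &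
    forall x', X x' -> N1 (x' - x) < d -> N1 (G x' - G x) < e.
Proof.
move=> /subspace_continuousP cG x Xx e e0.
have /(cG x Xx) : nbhs (G x) [set y | N1 (y - G x) < e] by apply/nbhs_N1; exists e.
by rewrite nbhs_simpl /= => /nbhs_N1[d d0 hd]; exists d => // x' Xx' /hd; apply.
Qed.

End Topology.

(** * Perturbations with nonclosed image *)

Section Perturbation.
Variables (R : realType) (n m : nat) (X : set 'cV[R]_n) (G : 'cV[R]_n -> 'cV[R]_m).
Hypothesis sX : sa X.
Hypothesis dG : dmap G.
Hypothesis cX : closed X.
Hypothesis cG : {within X, continuous G}.

Definition residual (F : 'M[R]_(m, n)) (y : 'cV[R]_m) (x : 'cV[R]_n) := F *m x + G x - y.

(** The penalty [c] is the slope of the variational principle in [nearly_critical_ex], and 0 in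
    [nonclosed_escapes]. *)
Lemma residual_continuous F y c x0 : 0 <= c -> forall x, X x -> forall e, 0 < e ->
  exists2 d, 0 < d & forall x', X x' -> N1 (x' - x) < d ->
    `|(N1 (residual F y x') + c * N1 (x' - x0)) - (N1 (residual F y x) + c * N1 (x - x0))| < e.
Proof.
move=> c0 x Xx e e0; have [B B0 hB] := N1_mulmx F.
have e20 : 0 < e / 2 by lra.
have [d d0 hd] := within_N1 cG Xx e20.
have Bc0 : 0 < B + c by lra.
(* Half of [e] is left to the variation of [G], half to the terms with Lipschitz constant
   [B + c]. *)
pose d' := Num.min d (e / 2 / (B + c)).
exists d'; first by rewrite lt_min d0 !divr_gt0.
move=> x' Xx'; rewrite lt_min => /andP[/(hd _ Xx') h1]; rewrite ltr_pdivlMr // => h2.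
have r1 : `|N1 (residual F y x') - N1 (residual F y x)| <= B * N1 (x' - x) + N1 (G x' - G x).
  apply: le_trans (N1_lip _ _) _.
  have -> : residual F y x' - residual F y x = F *m (x' - x) + (G x' - G x).
    rewrite /residual mulmxBr; apply/matrixP => i j; rewrite !mxE; ring.
  by apply: le_trans (N1D _ _) _; rewrite lerD2r.
have r2 : `|N1 (x' - x0) - N1 (x - x0)| <= N1 (x' - x).
  apply: le_trans (N1_lip _ _) _; suff -> : x' - x0 - (x - x0) = x' - x by [].
  by apply/matrixP => i j; rewrite !mxE; ring.
have -> : forall p q r s : R, p + c * q - (r + c * s) = (p - r) + c * (q - s) by move=> *; ring.
apply: le_lt_trans (ler_normD _ _) _; rewrite normrM (ger0_norm c0).
have r3 := ler_wpM2l c0 r2.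
by move: h2; rewrite mulrDr [_ * B]mulrC [_ * c]mulrC; lra.
Qed.

Definition cell := ('I_m * 'I_n * bool * bool)%type.

(* [x] is an approximate local minimiser of the distance from [y] to the image, at scale [r];
   the cell records a nonzero coordinate of the residual and a dominating coordinate of [x],
   with their signs. *)
Definition nearly_critical (c : cell) (C : R) (F : 'M[R]_(m, n)) (r : R) (x : 'cV[R]_n) (y : 'cV[R]_m) :=
  let: (i, k, a, b) := c in
  (X x /\ N1 x <= 2 * r) /\ (r <= (2 * n)%:R * ((-1) ^+ b * x k 0) /\ N1 y <= C) /\
  (N1 (residual F y x) <= 1 /\ 0 < (-1) ^+ a * residual F y x i 0) /\
  forall x', X x' -> r * (N1 (residual F y x) - N1 (residual F y x')) <= 2 * N1 (x' - x).

(** First-order in [F] once [c] and [C] are fixed. Cells are finite in number and [C] may be taken a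
    natural number, so Baire's theorem applies to these sets. *)
Definition escapes (c : cell) (C : R) (F : 'M[R]_(m, n)) :=
  forall r, C <= r -> exists x, exists y, nearly_critical c C F r x y.

Lemma dmap_residual (T : cspace R) (F : T -> 'M[R]_(m, n)) y x : dmap F -> dmap y -> dmap x ->
  dmap (fun t => residual (F t) (y t) (x t)).
Proof.
move=> dF dy dx; rewrite /residual.
have dGx : dmap (fun t => G (x t)) by exact: (dmap_comp dG dx).
exact: (dmap_addmx (dmap_addmx (dmap_mulmx dF dx) dGx) (dmap_oppmx dy)).
Qed.

Lemma sa_nearly_critical c C (T : cspace R) (F : T -> 'M[R]_(m, n)) r x y :
  dmap F -> dmap r -> dmap x -> dmap y -> sa (fun t => nearly_critical c C (F t) (r t) (x t) (y t)).
Proof.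
case: c => [[[i k] a] b] dF dr dx dy; rewrite /nearly_critical.
have dres := dmap_residual dF dy dx.
have d1 : dmap (fun z : T * 'cV[R]_n => F z.1) by apply: (dmap_comp dF); definable.
have d2 : dmap (fun z : T * 'cV[R]_n => y z.1) by apply: (dmap_comp dy); definable.
have d3 : dmap (fun z : T * 'cV[R]_n => x z.1) by apply: (dmap_comp dx); definable.
have d4 : dmap (fun z : T * 'cV[R]_n => r z.1) by apply: (dmap_comp dr); definable.
have d5 : dmap (fun z : T * 'cV[R]_n => z.2) by definable.
have dr1 := dmap_residual d1 d2 d3; have dr2 := dmap_residual d1 d2 d5.
apply: sa_and; first apply: sa_and.
- exact: (sa_comp sX dx).
- by apply: sa_le; [exact: dmap_N1|exact: dmap_mul (dmap_const _ _) dr].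
apply: sa_and; first apply: sa_and.
- by apply: sa_le => //; do 2 (apply: dmap_mul; first exact: dmap_const); apply: dmap_entry.
- by apply: sa_le; [exact: dmap_N1|exact: dmap_const].
apply: sa_and; first apply: sa_and.
- by apply: sa_le; [exact: dmap_N1|exact: dmap_const].
- apply: sa_lt; first exact: dmap_const.
  by apply: dmap_mul; [exact: dmap_const|exact: dmap_entry].
apply: sa_all; apply: sa_imp; first exact: (sa_comp sX d5).
apply: sa_le.
  apply: dmap_mul => //; apply: dmap_add; first exact: dmap_N1.
  by apply: dmap_opp; exact: dmap_N1.
apply: dmap_mul; first exact: dmap_const.
by apply: dmap_N1; exact: (dmap_addmx d5 (dmap_oppmx d3)).
Qed.

Lemma sa_escapes c C : sa (escapes c C).
Proof.
rewrite /escapes; definable.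
by apply: sa_nearly_critical; definable.
Qed.

(** Ekeland's principle: the distance to [y] plus a linear penalty centred at [x0] is minimised on
    the ball of radius r / 2, which keeps the norm of the minimiser between r / 2 and 3r / 2. *)
Lemma nearly_critical_ex F y x0 r : X x0 -> N1 x0 = r -> 0 < r -> N1 (residual F y x0) <= 1 ->
  (forall x, X x -> residual F y x != 0) ->
  exists c, exists x, nearly_critical c (N1 y) F r x y.
Proof.
move=> Xx0 Nx0 r0 res1 resn0.
(* With slope [e] the penalty at distance r / 2 equals [p], the value at [x0], so the minimum on the
   ball is global on [X]. As [p] is at most 1, the slope is at most 2 / r. *)
pose p := N1 (residual F y x0); pose e := 2 * p / r.
have p0 : 0 <= p by exact: N1_ge0.
have e0 : 0 <= e by rewrite /e divr_ge0 ?mulr_ge0 // ltW.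
have er : e * r = 2 * p by rewrite /e divfK ?gt_eqF.
have r20 : 0 <= r / 2 by lra.
have [x [Xx xr hx]] := bounded_minimum cX (residual_continuous F y x0 e0) Xx0 r20.
have hx0 : N1 (residual F y x) + e * N1 (x - x0) <= p.
  by have := hx x0 Xx0; rewrite subrr N1_0 mulr0 addr0; apply.
have ex0 : 0 <= e * N1 (x - x0) by rewrite mulr_ge0 // N1_ge0.
have glob x' : X x' -> r * (N1 (residual F y x) - N1 (residual F y x')) <= 2 * N1 (x' - x).
  move=> Xx'.
  have h : N1 (residual F y x) + e * N1 (x - x0) <= N1 (residual F y x') + e * N1 (x' - x0).
    have [/(hx _ Xx')//|far] := leP (N1 (x' - x0)) (r / 2).
    have h1 : e * (r / 2) <= e * N1 (x' - x0) by rewrite ler_wpM2l // ltW.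
    by have := N1_ge0 (residual F y x'); lra.
  have t1 : e * N1 (x' - x0) <= e * (N1 (x' - x) + N1 (x - x0)) by rewrite ler_wpM2l // N1_triangle.
  have h2 : N1 (residual F y x) - N1 (residual F y x') <= e * N1 (x' - x) by lra.
  have := ler_wpM2l (ltW r0) h2; rewrite mulrA [r * e]mulrC er => /le_trans; apply.
  by rewrite -mulrA ler_wpM2l // ler_piMl // N1_ge0.
have [i vi] : exists i, residual F y x i 0 != 0.
  apply: contrapT => nv; move/negP: (resn0 x Xx); apply; apply/eqP/matrixP => i j.
  by rewrite ord1 [RHS]mxE; apply/eqP/negPn/negP => vi; apply: nv; exists i.
have xlow : r <= 2 * N1 x.
  by have := N1_triangle x0 x 0; rewrite !subr0 Nx0 (N1B x0 x); lra.
(* The largest coordinate is at least the average, and the norm of [x] is at least r / 2. *)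
have [k xk] : exists k, r <= (2 * n)%:R * `|x k 0|.
  apply: contrapT => nk.
  have : 2 * N1 x * n%:R < r * n%:R.
    have nn : (0 < n)%N.
      case: (posnP n) => // n0; move: xlow; rewrite /N1 big1 ?mulr0; first by lra.
      by move=> i'; have := ltn_ord i'; rewrite {2}n0.
    rewrite /N1 mulrAC -natrM mulr_sumr.
    have -> : r * n%:R = \sum_(i < n) r by rewrite big_const_ord iter_addr_0 mulr_natr.
    apply: ltr_sum => [|k _]; first by apply/hasP; exists (Ordinal nn); rewrite ?mem_index_enum.
    by rewrite ltNge; apply/negP => h; apply: nk; exists k.
  by apply/negP; rewrite -leNgt ler_wpM2r.
have sgP (z : R) : exists b : bool, (-1) ^+ b * z = `|z|.
  have [z0|z0] := leP 0 z; first by exists false; rewrite expr0 mul1r ger0_norm.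
  by exists true; rewrite expr1 mulN1r ltr0_norm.
have [a ha] := sgP (residual F y x i 0); have [b hb] := sgP (x k 0).
exists (i, k, a, b), x; split; first split=> //.
  by have := N1_triangle x x0 0; rewrite !subr0 Nx0; lra.
split; first by rewrite hb.
split; last exact: glob.
by rewrite ha normr_gt0; split=> //; apply: le_trans res1; rewrite -/p; lra.
Qed.

(** The norms of points of [X] with residual at most 1 form a semialgebraic set of reals, which
    eventually contains every number or none; the second case would put [y] in the image or outside
    its closure. *)
Lemma nonclosed_escapes F : ~ closed [set F *m x + G x | x in X] ->
  exists ck : cell * nat, escapes ck.1 ck.2%:R F.
Proof.
move=> /closed_N1; rewrite -existsNE => -[y]; rewrite not_implyE => -[hy ny].
have resn0 x : X x -> residual F y x != 0.
  by move=> Xx; apply/negP; rewrite /residual subr_eq0 => /eqP h; apply: ny; exists x.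
pose A := [set t : R | exists x, X x /\ (N1 x = t /\ N1 (residual F y x) <= 1)].
have sA : sa A.
  rewrite /A /mkset; definable; [exact: (sa_comp sX (dmap_snd (dmap_id _)))| |].
    exact: (dmap_N1 (dmap_snd (dmap_id _))).
  by apply: dmap_N1; apply: dmap_residual; definable.
have [t0 [hA|hA]] := sa_eventually sA; last first.
  have bnd x : X x -> N1 (residual F y x) <= 1 -> N1 x <= `|t0|.
    move=> Xx h; rewrite leNgt; apply/negP => lt; apply: (hA (N1 x)); last by exists x.
    by rewrite (le_trans (ler_norm _)) // ltW.
  have [_ [[x1 Xx1 <-] ax1]] := hy 1 ltr01.
  have c00 : (0 : R) <= 0 by [].
  have r0 : 0 <= `|t0| + N1 x1 by rewrite addr_ge0 // N1_ge0.
  (* This ball around [x1] contains every point of norm at most [|t0|], hence all points with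
     residual at most 1; the minimum is positive, so values closer to [y] give a contradiction. *)
  have [x [Xx xr hx]] := bounded_minimum cX (residual_continuous F y 0 c00) Xx1 r0.
  have px : 0 < N1 (residual F y x).
    rewrite lt_neqAle N1_ge0 andbT eq_sym; apply/eqP => /N1_eq0 /eqP h.
    by move/negP: (resn0 x Xx).
  have m0 : 0 < Num.min 1 (N1 (residual F y x)) by rewrite lt_min ltr01.
  have [_ [[x' Xx' <-]]] := hy _ m0; rewrite -/(residual F y x') lt_min => /andP[h1 h2].
  have := hx x' Xx'; rewrite !mul0r !addr0 => /(_ _) h3.
  have : N1 (x' - x1) <= `|t0| + N1 x1.
    by rewrite (le_trans (N1D _ _)) // N1N lerD2r bnd // ltW.
  by move=> /h3; rewrite leNgt h2.
have sE (c : cell) : sa (fun r => exists x, nearly_critical c (N1 y) F r x y).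
  by definable; apply: sa_nearly_critical; definable.
have /choice[t ht] := fun c => sa_eventually (sE c).
(* Each cell occurs for all large [r] or for none. At an [r] beyond all thresholds some cell occurs,
   hence that one always does. *)
have ev : exists c, forall r, t c <= r -> exists x, nearly_critical c (N1 y) F r x y.
  apply: contrapT => nc.
  pose r := 1 + `|t0| + \sum_c `|t c|.
  have s0 : 0 <= \sum_c `|t c| by exact: sumr_ge0.
  have rt0 : t0 <= r by have := ler_norm t0; rewrite /r; lra.
  have r0 : 0 < r by have := normr_ge0 t0; rewrite /r; lra.
  have [x0 [Xx0 [Nx0 h0]]] := hA r rt0.
  have [c hc] := nearly_critical_ex Xx0 Nx0 r0 h0 resn0.
  have [h|h] := ht c; first by apply: nc; exists c.
  apply: (h r) => //; have := ler_norm (t c); have := normr_ge0 t0.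
  have : `|t c| <= \sum_c `|t c| by rewrite (bigD1 c) //= lerDl sumr_ge0.
  by rewrite /r; lra.
have [c hc] := ev.
(* One natural number dominates both the threshold of the cell and the norm of [y]. *)
exists (c, (Num.truncn (`|t c| + N1 y)).+1) => r /=.
set C := _%:R => Cr.
have Cge : `|t c| + N1 y <= C.
  by apply/ltW; rewrite /C; apply: truncnS_gt.
have tr : t c <= r by have := ler_norm (t c); have := N1_ge0 y; lra.
have [x hx] := hc r tr; exists x, y; move: hx; rewrite /nearly_critical.
case: (c) => -[[i k] a] b [h1 [[h2 _] h3]]; split=> //; split=> //; split=> //.
by have := normr_ge0 (t c); lra.
Qed.

End Perturbation.

(** * Density *)

Section Contradiction.
Variables (R : realType) (n m : nat) (X : set 'cV[R]_n) (G : 'cV[R]_n -> 'cV[R]_m).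
Hypothesis sX : sa X.
Hypothesis dG : dmap G.

Lemma dmap_usubmx (T : cspace R) (f : T -> 'cV[R]_(n + m)) :
  dmap f -> dmap (fun t => usubmx (f t)).
Proof.
move=> hf; apply: dmap_mx => i j.
have -> : (fun t => usubmx (f t) i j) = (fun t => f t (lshift m i) j).
  by apply/funext => t; rewrite mxE.
exact: dmap_entry.
Qed.

Lemma dmap_dsubmx (T : cspace R) (f : T -> 'cV[R]_(n + m)) :
  dmap f -> dmap (fun t => dsubmx (f t)).
Proof.
move=> hf; apply: dmap_mx => i j.
have -> : (fun t => dsubmx (f t) i j) = (fun t => f t (rshift n i) j).
  by apply/funext => t; rewrite mxE.
exact: dmap_entry.
Qed.

Lemma N1_shrink k (v : 'cV[R]_k) i (a : bool) c : 0 <= c -> c <= (-1) ^+ a * v i 0 ->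
  N1 (v - ((-1) ^+ a * c) *: delta_mx i 0) = N1 v - c.
Proof.
move=> c0 cv; rewrite /N1 (bigD1 i) //= [in RHS](bigD1 i) //= !mxE !eqxx mulr1.
rewrite (eq_bigr (fun j => `|v j 0|)); last first.
  by move=> j /negbTE ji; rewrite !mxE ji mulr0 subr0.
rewrite addrAC; congr (_ + _); case: a cv; rewrite ?expr0 ?expr1 ?mul1r ?mulN1r => cv.
  by rewrite opprK ler0_norm ?[`|v i 0|]ler0_norm; lra.
by rewrite !ger0_norm; lra.
Qed.

(** The competitor [x'] is tested in the near minimality of [x]. Passing from [F'] back to [F] moves
    coordinate [i] of its residual towards 0 by at least s r / (2n), up to [y' - y]; the smallness
    of [s] prevents overshooting 0, so the norm drops by the full amount. *)
Lemma nearly_critical_step c C F F' s r x x' y y' : 0 < r -> 0 <= s ->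
  nearly_critical X G c C F r x y -> nearly_critical X G c C F' r x' y' ->
  let: (i, k, a, b) := c in
  F' = F + s *: (((-1) ^+ a * (-1) ^+ b) *: delta_mx i k) ->
  s * (2 * r) <= (-1) ^+ a * residual G F' y' x' i 0 ->
  s * (r / (2 * n)%:R) + N1 (residual G F y x) <=
    N1 (residual G F' y' x') + (N1 (y' - y) + 2 / r * N1 (x' - x)).
Proof.
case: c => [[[i k] a] b] r0 s0 [_ [_ [_ hx]]] [[Xx' Nx'] [[rx' _] _]] F'E small.
have n0 : 0 < (2 * n)%:R :> R by rewrite ltr0n; have := ltn_ord k; lia.
pose c := s * ((-1) ^+ b * x' k 0).
have xk : (-1) ^+ b * x' k 0 <= N1 x'.
  apply: le_trans (ler_norm _) (le_trans _ (N1_coord x' k)).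
  by rewrite normrM normrX normrN1 expr1n mul1r.
have rn : r / (2 * n)%:R <= (-1) ^+ b * x' k 0 by rewrite ler_pdivrMr // mulrC.
have c0 : s * (r / (2 * n)%:R) <= c by rewrite ler_wpM2l.
have c00 : 0 <= c by apply: le_trans c0; rewrite mulr_ge0 // divr_ge0 // ltW.
have cs : c <= (-1) ^+ a * residual G F' y' x' i 0.
  by apply: le_trans small; rewrite ler_wpM2l //; apply: le_trans Nx'.
have resE : residual G F y x' = (residual G F' y' x' - ((-1) ^+ a * c) *: delta_mx i 0) + (y' - y).
  have dE : delta_mx i k *m x' = x' k 0 *: delta_mx i (0 : 'I_1).
    apply/matrixP => p q; rewrite !mxE (bigD1 k) //= big1 ?addr0; last first.
      by move=> l /negbTE lk; rewrite !mxE lk andbF mul0r.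
    by rewrite !mxE !ord1 eqxx !andbT mulrC.
  rewrite /residual F'E mulmxDl -!scalemxAl dE !scalerA /c.
  by apply/matrixP => p q; rewrite !mxE; ring.
have := hx x' Xx'.
have : N1 (residual G F y x') <= N1 (residual G F' y' x') - c + N1 (y' - y).
  by rewrite resE (le_trans (N1D _ _)) // lerD2r N1_shrink.
move=> h1 h2.
have h3 : N1 (residual G F y x) - N1 (residual G F y x') <= 2 / r * N1 (x' - x).
  by rewrite mulrAC ler_pdivlMr // mulrC.
by lra.
Qed.

Lemma not_open_escapes c C (V : set 'M[R]_(m, n)) : open V -> V !=set0 ->
  V `<=` escapes X G c C -> False.
Proof.
move=> oV [F0 VF0] hV.
case cE : c => [[[i k] a] b].
have n0 : (0 < n)%N by have := ltn_ord k; lia.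
pose H : 'M[R]_(m, n) := ((-1) ^+ a * (-1) ^+ b) *: delta_mx i k.
pose Fs s := F0 + s *: H.
have [d d0 hd] : exists2 d, 0 < d & forall s, 0 <= s <= d -> V (Fs s).
  have /nbhs_mx[e e0 he] : nbhs F0 V by exact: open_nbhs_nbhs.
  exists (e / 2); first by lra.
  move=> s /andP[s0 se]; apply: he => p q; rewrite /Fs /H !mxE [X in X - _]addrC addrK.
  rewrite !normrM !normrX normrN1 !expr1n !mul1r ger0_norm //.
  case: (_ && _); rewrite ?normr1 ?normr0 ?mulr1 ?mulr0 //=; by lra.
have dFs (T : cspace R) (s : T -> R) : dmap s -> dmap (fun t => Fs (s t)).
  move=> ds; exact: (dmap_addmx (dmap_const _ F0) (dmap_scalemx ds (dmap_const _ H))).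
(* [x] and [y] are stacked in one vector, so that a single definable choice, in the scale and the
   position on the segment, selects both. *)
pose P (rs : R * R) (z : 'cV[R]_(n + m)) :=
  nearly_critical X G c C (Fs rs.2) rs.1 (usubmx z) (dsubmx z).
have sP : sa (fun w : (R * R) * 'cV[R]_(n + m) => P w.1 w.2).
  rewrite /P; apply: sa_nearly_critical => //.
  - by apply: dFs; definable.
  - by definable.
  - by apply: dmap_usubmx; definable.
  - by apply: dmap_dsubmx; definable.
have bP rs z : P rs z -> N1 (usubmx z) <= 2 * rs.1 /\ N1 (dsubmx z) <= C.
  by rewrite /P cE => -[[_ h1] [[_ h2] _]].
have [f [df hf]] : exists f : R * R -> 'cV[R]_(n + m), dmap f /\
    forall rs, (exists z, P rs z) -> P rs (f rs).
  apply: definable_choice sP _ => rs; exists (- (2 * `|rs.1| + `|C|)) => z /bP[h1 h2] j.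
  have low (w : R) B : `|w| <= B -> - B <= w by rewrite ler_norml => /andP[].
  apply: low; have hr := ler_norm rs.1; have hC := ler_norm C.
  have hr0 := normr_ge0 rs.1; have hC0 := normr_ge0 C.
  rewrite -[z]vsubmxK; case: (fintype.splitP j) => l jl.
    have -> : j = lshift m l by apply: val_inj.
    by rewrite col_mxEu; have := N1_coord (usubmx z) l; lra.
  have -> : j = rshift n l by apply: val_inj.
  by rewrite col_mxEd; have := N1_coord (dsubmx z) l; lra.
have spec r s : C <= r -> 0 <= s <= d -> P (r, s) (f (r, s)).
  move=> Cr sd; apply: hf; have [x [y xy]] := hV _ (hd s sd) r Cr.
  by exists (col_mx x y); rewrite /P col_mxKu col_mxKd.
have dfw : dmap (fun w : (R * R) * R => f (w.1.1, w.2)).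
  by apply: (dmap_comp df); definable.
(* The bounds are uniform in the scale and the level; hence [r] can be chosen after [N]. *)
have /choice[Nc hNc] : forall j : 'I_(n + m), exists N, forall rc : R * R, exists z : seq R,
    (size z <= N)%N /\ switches_in z (fun s => rc.2 < f (rc.1, s) j 0).
  move=> j; apply: (@sa_switches _ _ (fun w : (R * R) * R => w.1.2 < f (w.1.1, w.2) j 0)).
  by apply: sa_lt; [definable|apply: dmap_entry].
pose res r s := (-1) ^+ a * residual G (Fs s) (dsubmx (f (r, s))) (usubmx (f (r, s))) i 0.
have [Nr hNr] : exists N, forall rc : R * R, exists z : seq R,
    (size z <= N)%N /\ switches_in z (fun s => rc.2 <= res rc.1 s).
  apply: (@sa_switches _ _ (fun w : (R * R) * R => w.1.2 <= res w.1.1 w.2)).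
  apply: sa_le; first by definable.
  apply: dmap_mul; first exact: dmap_const.
  apply: dmap_entry; apply: dmap_residual => //; first by apply: dFs; definable.
    exact: dmap_dsubmx.
  exact: dmap_usubmx.
pose N := (Nr + \sum_j Nc j)%N.
have NcN j : (Nc j <= N)%N by rewrite /N (bigD1 j) //= addnCA leq_addr.
(* Leaves room in the segment for N + 1 disjoint intervals of length [d']. *)
pose d' := d / (N.+1 * 2)%:R.
have d'0 : 0 < d' by rewrite /d' divr_gt0.
have d'd : d' * (N.+1 * 2)%:R = d by rewrite /d' divfK // pnatr_eq0.
have nR : 0 < (2 * n)%:R :> R by rewrite ltr0n muln_gt0.
(* Bounds the total of the right-hand sides of all steps: 1 for the residual norm, then the
   variations of [y] and of [x]. The latter is O(r), and its factor [r] cancels against 2 / r. *)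
have [M [ME M0]] : exists M : R,
    M = 1 + m%:R * ((2 * N)%:R * (`|C| + `|C|)) + 2 * (n%:R * ((2 * N)%:R * 4)) /\ 0 <= M.
  by eexists; split; [reflexivity|rewrite !addr_ge0 // !mulr_ge0 // addr_ge0].
pose r := `|C| + 1 + (2 * n)%:R * M / d'.
have Mr0 : 0 <= (2 * n)%:R * M / d' by rewrite divr_ge0 ?mulr_ge0 // ltW.
have Cr : C <= r by have := ler_norm C; rewrite /r; lra.
have r0 : 0 < r by have := normr_ge0 C; rewrite /r; lra.
have rM : M < d' * (r / (2 * n)%:R).
  rewrite mulrA ltr_pdivlMr // /r !mulrDr mulr1 [d' * (_ / d')]mulrC divfK ?gt_eqF //.
  have : 0 <= d' * `|C| by rewrite mulr_ge0 // ltW.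
  by rewrite [M * _]mulrC; lra.
have pt0 (l : 'I_N.+1) : 0 <= d' * (l * 2)%:R <= d.
  rewrite mulr_ge0 ?(ltW d'0) //= -d'd ler_wpM2l ?(ltW d'0) // ler_nat.
  by rewrite leq_mul2r ltnW.
have res_pos s : 0 <= s <= d -> 0 < res r s.
  by move=> sd; have := spec r s Cr sd; rewrite /P cE => -[_ [_ [[_ h] _]]].
(* The inverse of the sum of inverses is a positive lower bound for finitely many positive
   numbers. *)
have [rho rho0 hrho] : exists2 rho, 0 < rho & forall l : 'I_N.+1, rho <= res r (d' * (l * 2)%:R).
  exists (\sum_(l < N.+1) (res r (d' * (l * 2)%:R))^-1)^-1 => [|l].
    rewrite invr_gt0 big_ord_recl ltr_pwDl ?invr_gt0 ?res_pos ?(pt0 ord0) //.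
    by apply: sumr_ge0 => l _; rewrite invr_ge0 ltW // res_pos ?(pt0 (lift ord0 l)).
  have rl := res_pos _ (pt0 l).
  rewrite -[leRHS]invrK lef_pV2 ?posrE ?invr_gt0 //; rewrite (bigD1 l) //=.
    by rewrite lerDl sumr_ge0 // => l' _; rewrite invr_ge0 ltW // res_pos.
  by rewrite ltr_pwDl ?invr_gt0 // sumr_ge0 // => l' _; rewrite invr_ge0 ltW // res_pos.
have [z [zN hz]] := hNr (r, rho).
(* On an interval without switches, the bound [rho] at the left endpoint persists throughout. *)
have [l0 hl0] := disjoint_interval (leq_trans zN (leq_addr (\sum_j Nc j) Nr)) d'0.
pose a0 := d' * (l0 * 2)%:R.
have a00 : 0 <= a0 by case/andP: (pt0 l0).
have a0d : a0 + d' <= d.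
  rewrite -d'd /a0 -{2}[d']mulr1 -mulrDr ler_wpM2l ?(ltW d'0) // natr1 ler_nat.
  by rewrite !muln2 ltn_double.
have rhores s : a0 <= s <= a0 + d' -> rho <= res r s.
  case/andP=> h1 h2; have [h _] : (rho <= res r a0) <-> (rho <= res r s).
    by apply: (hz a0 s h1) => w wz /andP[wa ws]; apply: (hl0 w wz); rewrite wa (le_trans ws h2).
  exact: h (hrho l0).
(* The subdivision is fine enough for the smallness condition of [nearly_critical_step], with [rho]
   as lower bound of the residual coordinate. *)
pose K := (Num.truncn (2 * r * d' / rho)).+1.
have K0 : 0 < K%:R :> R by rewrite ltr0n.
pose tau := d' / K%:R.
have tau0 : 0 < tau by rewrite divr_gt0.
have tauK : tau * K%:R = d' by rewrite /tau divfK // gt_eqF.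
have taurho : tau * (2 * r) <= rho.
  rewrite /tau mulrAC ler_pdivrMr // [rho * _]mulrC -ler_pdivrMr // [d' * _]mulrC.
  by apply/ltW; rewrite /K; exact: truncnS_gt.
pose t (l : nat) := a0 + tau * l%:R.
have tI l : (l <= K)%N -> a0 <= t l <= a0 + d'.
  move=> lK; rewrite /t lerDl mulr_ge0 ?(ltW tau0) //= lerD2l -tauK.
  by rewrite ler_wpM2l ?(ltW tau0) // ler_nat.
have tD l : (l <= K)%N -> 0 <= t l <= d.
  by move=> /tI/andP[h1 h2]; rewrite (le_trans a00 h1) (le_trans h2 a0d).
have tS l : t l.+1 = t l + tau by rewrite /t -natr1; ring.
pose g l := f (r, t l).
have gP l : (l <= K)%N -> P (r, t l) (g l) by move=> /tD; exact: spec.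
have var j B : 0 <= B -> (forall l, (l <= K)%N -> `|g l j 0| <= B) ->
    \sum_(l < K) `|g l.+1 j 0 - g l j 0| <= (2 * N)%:R * (B + B).
  move=> B0 hB; have -> : B + B = B - - B by rewrite opprK.
  apply: (@variation_le_crossings _ K t (fun l => g l j 0)).
  - by move=> l _; rewrite tS ltrDl.
  - by move=> l /hB; rewrite ler_norml.
  - move=> c'; have [zc [zcN hzc]] := hNc j (r, c').
    exists zc; split; first exact: leq_trans zcN (NcN j).
    move=> l _ hw; have := hzc (t l) (t l.+1) _ hw; rewrite tS lerDl (ltW tau0) => /(_ isT) /= h.
    by apply/idP/idP; rewrite /g tS; case: h.
pose xs l := usubmx (g l); pose ys l := dsubmx (g l).
have vary : \sum_(l < K) N1 (ys l.+1 - ys l) <= m%:R * ((2 * N)%:R * (`|C| + `|C|)).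
  rewrite /N1 exchange_big /=.
  have -> : m%:R * ((2 * N)%:R * (`|C| + `|C|)) = \sum_(j < m) (2 * N)%:R * (`|C| + `|C|).
    by rewrite big_const_ord iter_addr_0 mulr_natl.
  apply: ler_sum => j _; under eq_bigr do rewrite !mxE.
  apply: var => // l lK; have [_ h] := bP _ _ (gP l lK).
  have := N1_coord (ys l) j; rewrite mxE => /le_trans; apply.
  exact: le_trans h (ler_norm C).
have varx : \sum_(l < K) N1 (xs l.+1 - xs l) <= n%:R * ((2 * N)%:R * (2 * r + 2 * r)).
  rewrite /N1 exchange_big /=.
  have -> : n%:R * ((2 * N)%:R * (2 * r + 2 * r)) = \sum_(j < n) (2 * N)%:R * (2 * r + 2 * r).
    by rewrite big_const_ord iter_addr_0 mulr_natl.
  apply: ler_sum => j _; under eq_bigr do rewrite !mxE.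
  apply: var => [|l lK]; first by rewrite mulr_ge0 // ltW.
  have [h _] := bP _ _ (gP l lK).
  by have := N1_coord (xs l) j; rewrite mxE => /le_trans; apply.
pose v l := N1 (residual G (Fs (t l)) (ys l) (xs l)).
have step l : (l < K)%N -> tau * (r / (2 * n)%:R) <=
    (v l.+1 - v l) + (N1 (ys l.+1 - ys l) + 2 / r * N1 (xs l.+1 - xs l)).
  move=> lK.
  have h1 : nearly_critical X G c C (Fs (t l)) r (xs l) (ys l) := gP l (ltnW lK).
  have h2 : nearly_critical X G c C (Fs (t l.+1)) r (xs l.+1) (ys l.+1) := gP l.+1 lK.
  have := nearly_critical_step r0 (ltW tau0) h1 h2; rewrite cE => h.
  have FE : Fs (t l.+1) = Fs (t l) + tau *: H by rewrite /Fs tS scalerDl addrA.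
  have {}h := h FE (le_trans taurho (rhores _ (tI _ lK))).
  by rewrite addrAC lerBrDr; exact: h.
(* The left side sums to [d' * (r / (2 * n)%:R)] whatever [K] is, and exceeds [M]; the residual
   norms telescope. *)
have : \sum_(l < K) tau * (r / (2 * n)%:R) <= \sum_(l < K)
    ((v l.+1 - v l) + (N1 (ys l.+1 - ys l) + 2 / r * N1 (xs l.+1 - xs l))).
  by apply: ler_sum => l _; exact: step.
rewrite big_split [X in _ <= _ + X]big_split /= -[X in _ <= _ + (_ + X)]mulr_sumr.
rewrite -(big_mkord xpredT (fun l => v l.+1 - v l)) telescope_sumr //.
rewrite big_const_ord iter_addr_0 -mulrnAl -[tau *+ K]mulr_natr tauK.
have v0 : 0 <= v 0%N by exact: N1_ge0.
have vK : v K <= 1.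
  by have := gP K (leqnn K); rewrite /P cE => -[_ [_ [[h _] _]]].
have varx' : 2 / r * (\sum_(l < K) N1 (xs l.+1 - xs l)) <= 2 * (n%:R * ((2 * N)%:R * 4)).
  have -> : 2 * (n%:R * ((2 * N)%:R * 4)) = 2 / r * (n%:R * ((2 * N)%:R * (2 * r + 2 * r))).
    by field; rewrite gt_eqF.
  by rewrite ler_wpM2l // divr_ge0 // ltW.
apply/negP; rewrite -ltNge; apply: le_lt_trans rM; rewrite ME -[leRHS]addrA.
apply: lerD; last exact: lerD vary varx'.
by rewrite lerBlDr (le_trans vK) // lerDl.
Qed.

End Contradiction.

(** * The set of linear perturbations with closed image *)

Theorem mainTheorem1 (R : realType) (n m : nat)
  (X : set 'cV[R]_n) (G : 'cV[R]_n -> 'cV[R]_m) :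
  closed X -> semialgebraic X ->
  {within X, continuous G} -> semialgebraic_map X G ->
  let T := [set F : 'M[R]_(m, n) | closed [set F *m x + G x | x in X]] in
  semialgebraic T /\
  exists U : set 'M[R]_(m, n),
    [/\ semialgebraic U, open U, dense U & U `<=` T].
Proof.
move=> cX /sa_semialgebraic sX cG /sa_semialgebraic sG T.
(* Extension by 0 outside [X] gives a total map, as [dmap] requires, with the same images of [X]. *)
pose G' x := if asbool (X x) then G x else 0.
have G'E x : X x -> G' x = G x by move=> Xx; rewrite /G' (asboolT Xx).
have dG' : dmap G'.
  have graph : sa (fun z : 'cV[R]_n * 'cV[R]_m => exists2 x, X x & col_mx x (G x) = col_mx z.1 z.2).
    exact: (sa_comp sG (dmap_col_mx (dmap_fst (dmap_id _)) (dmap_snd (dmap_id _)))).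
  have Xz : sa (fun z : 'cV[R]_n * 'cV[R]_m => X z.1).
    exact: (sa_comp sX (dmap_fst (dmap_id _))).
  have z0 : sa (fun z : 'cV[R]_n * 'cV[R]_m => z.2 = 0).
    exact: (sa_eq (dmap_snd (dmap_id _)) (dmap_const _ _)).
  apply: sa_ext (sa_or graph (sa_and (sa_not Xz) z0)) => -[x y] /=; split.
    case=> [[x' Xx' /eq_col_mx[<- <-]]|[nX ->]]; first by rewrite G'E.
    by rewrite /G' asboolF.
  move=> ->; rewrite /G'; case: asboolP => Xx; [left|right] => //.
  by exists x.
have cG' : {within X, continuous G'}.
  apply/subspace_continuousP => x Xx.
  move/subspace_continuousP: cG => /(_ x Xx); rewrite /from_subspace (G'E x Xx).
  apply: cvg_trans; apply: near_eq_cvg.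
  by rewrite near_withinE; near=> x' => Xx'; rewrite G'E.
have imE F : [set F *m x + G x | x in X] = [set F *m x + G' x | x in X].
  by apply/seteqP; split=> y [x Xx <-]; exists x; rewrite ?G'E.
have TE : T = [set F | closed [set F *m x + G' x | x in X]].
  by apply/seteqP; split=> F; rewrite /T /= imE.
(* Closedness of the image is written as a first-order condition on [F], with quantifiers over [y],
   [e] and [x]. *)
have sT : sa T.
  have : sa (fun F : 'M[R]_(m, n) => forall y : 'cV[R]_m,
      (forall e : R, 0 < e -> exists x : 'cV[R]_n, X x /\ N1 (residual G' F y x) < e) ->
      exists x : 'cV[R]_n, X x /\ residual G' F y x = 0).
    definable; [exact: (sa_comp sX (dmap_snd (dmap_id _)))| |exact: (sa_comp sX (dmap_snd (dmap_id _)))|].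
      by apply: dmap_N1; apply: dmap_residual => //; definable.
    by apply: dmap_residual => //; definable.
  rewrite TE; apply: sa_ext => F; rewrite /= closed_N1; split=> h y hy.
    have [e e0|x [Xx /eqP]] := h y.
      by have [_ [[x Xx <-] xe]] := hy e e0; exists x.
    by rewrite subr_eq0 => /eqP; exists x.
  have [e e0|x Xx xy] := h y.
    by have [x [Xx xe]] := hy e e0; exists (F *m x + G' x); split=> //; exists x.
  by exists x; split=> //; rewrite /residual xy subrr.
split; first exact/sa_semialgebraic.
exists T°; split.
- exact/sa_semialgebraic/sa_interior.
- exact: open_interior.
- move=> V nV oV; apply: contrapT => nVT.
  (* If [V] missed the interior of [T], some nonempty open [W] inside [V] would lie outside [T] and
     be covered by the countably many sets [escapes]. *)
  have [W [oW nW WV [WT|WnT]]] := sa_decided sT oV nV.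
    have [F WF] := nW; apply: nVT; exists F; split; first exact: WV.
    by apply: (filterS WT); exact: open_nbhs_nbhs.
  have cover F : W F -> exists ck : cell n m * nat, escapes X G' ck.1 ck.2%:R F.
    by move=> /WnT nTF; apply: nonclosed_escapes => //; move: nTF; rewrite TE.
  have [ck [V' [oV' nV' V'esc]]] :=
    sa_cover (fun ck : cell n m * nat => sa_escapes sX dG' ck.1 ck.2%:R) oW nW cover.
  exact: not_open_escapes oV' nV' V'esc.
- exact: interior_subset.
Unshelve. all: by end_near. Qed.
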